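(* Let $\mathfrak{S}$ be a finite subset of $\mathbb{Z}^2$ that is symmetric with respect to the $y$-axis, i.e. $(i,j)\in\mathfrak{S}\Rightarrow(-i,j)\in\mathfrak{S}$, and has small horizontal variations, i.e. $(i,j)\in\mathfrak{S}\Rightarrow|i|\le 1$. Let $(i_0,j_0)\in\mathbb{N}^2$. Let $$Q(x,y;t)=\sum_{n\ge 0}t^n\sum_{i,j\ge 0}a_{i,j}(n)\,x^iy^j,$$ where $a_{i,j}(n)$ is the number of walks of length $n$ that start from $(i_0,j_0)$, end at $(i,j)$, take their steps in $\mathfrak{S}$ and stay in the first quadrant. Then the series $Q(x,y;t)$ is D-finite (in the three variables $x,y,t$).
   Context: $\mathbb{N}=\{0,1,2,\dots\}$. A walk of length $n$ with steps in $\mathfrak{S}$ is a sequence $(w_0,\dots,w_n)$ of points of $\mathbb{Z}^2$ with $w_k-w_{k-1}\in\mathfrak{S}$ for $1\le k\le n$; it starts from $w_0$ and ends at $w_n$. It stays in the first quadrant if every $w_k$ has both coordinates $\ge 0$. For a field $\mathbb{L}$ (here one may take $\mathbb{L}=\mathbb{Q}$), a power series $F\in\mathbb{L}[[x_1,\dots,x_k]]$ is D-finite (or holonomic) if its partial derivatives (of all orders) span a finite-dimensional vector space over the field of rational functions $\mathbb{L}(x_1,\dots,x_k)$, inside the fraction field of $\mathbb{L}[[x_1,\dots,x_k]]$. Equivalently, for each $1\le i\le k$, $F$ satisfies a non-trivial equation $\sum_{\ell=0}^{d_i}P_{\ell,i}\,\frac{\partial^\ell F}{\partial x_i^\ell}=0$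 with $P_{\ell,i}\in\mathbb{L}[x_1,\dots,x_k]$. *)

(* Defs.v *)
From HB Require Import structures.
From mathcomp Require Import all_boot all_order all_algebra fraction finmap.
From mathcomp Require Import boolp classical_sets cardinality.
From mathcomp Require Import mpoly.

Set Implicit Arguments.
Unset Strict Implicit.
Unset Printing Implicit Defensive.

Import Order.TTheory GRing.Theory Num.Theory.

Local Open Scope classical_set_scope.
Local Open Scope ring_scope.

(* The ring R[[x_0, ..., x_(n-1)]]; a series is its family of coefficients,
   indexed by exponent vectors. *)
Record mpseries (n : nat) (R : Type) : Type :=
  MPSeries { scoeff : 'X_{1..n} -> R }.

Section Series.
Variables (n : nat).

Lemma mpseriesP (R : Type) (f g : mpseries n R) :
  (forall m, scoeff f m = scoeff g m) -> f = g.
Proof. by case: f => f; case: g => g /= /funext ->. Qed.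

HB.instance Definition _ (R : Type) := gen_eqMixin (mpseries n R).
HB.instance Definition _ (R : Type) := gen_choiceMixin (mpseries n R).

Section Additive.
Variable R : zmodType.
Implicit Types f g h : mpseries n R.

Definition series_zero : mpseries n R := MPSeries (fun _ => 0).
Definition series_opp f : mpseries n R := MPSeries (fun m => - scoeff f m).
Definition series_add f g : mpseries n R :=
  MPSeries (fun m => scoeff f m + scoeff g m).

Fact series_addA : associative series_add.
Proof. by move=> f g h; apply: mpseriesP => m /=; rewrite addrA. Qed.
Fact series_addC : commutative series_add.
Proof. by move=> f g; apply: mpseriesP => m /=; rewrite addrC. Qed.
Fact series_add0 : left_id series_zero series_add.
Proof. by move=> f; apply: mpseriesP => m /=; rewrite add0r. Qed.
Fact series_addN : left_inverse series_zero series_opp series_add.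
Proof. by move=> f; apply: mpseriesP => m /=; rewrite addNr. Qed.

HB.instance Definition _ := GRing.isZmodule.Build (mpseries n R)
  series_addA series_addC series_add0 series_addN.

End Additive.

Section Ring.
Variable R : comNzRingType.
Implicit Types f g h : mpseries n R.

Definition series_of_mpoly (p : {mpoly R[n]}) : mpseries n R :=
  MPSeries (fun m => p@_m).

Definition series_one : mpseries n R := MPSeries (fun m => (m == 0%MM)%:R).

(* The bounds only make the set of pairs k with k.1 + k.2 = m a finite type. *)
Definition series_mul f g : mpseries n R := MPSeries (fun m =>
  \sum_(k : 'X_{1..n < (mdeg m).+1, (mdeg m).+1} | m == (k.1 + k.2)%MM)
     scoeff f k.1 * scoeff g k.2).

Let trunc (K : nat) f : {mpoly R[n]} :=
  \sum_(m : 'X_{1..n < K}) scoeff f m *: 'X_[m].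

Let mcoeff_trunc K f m : (mdeg m < K)%N -> (trunc K f)@_m = scoeff f m.
Proof. exact: mcoeff_mpoly. Qed.

Let series_mulE K f g m : (mdeg m < K)%N ->
  scoeff (series_mul f g) m = (trunc K f * trunc K g)@_m.
Proof.
move=> mK; rewrite (@mcoeff_poly_mul _ _ _ _ _ (mdeg m).+1) //=.
apply: eq_bigr => k _; congr (_ * _).
  by rewrite mcoeff_trunc // (leq_trans (bmdeg k.1)).
by rewrite mcoeff_trunc // (leq_trans (bmdeg k.2)).
Qed.

Let eq_mcoeffM K (p p' q : {mpoly R[n]}) m :
  (forall k, (mdeg k < K)%N -> p@_k = p'@_k) -> (mdeg m < K)%N ->
  (p * q)@_m = (p' * q)@_m.
Proof.
move=> pp' mK; rewrite !(@mcoeff_poly_mul _ _ _ _ _ (mdeg m).+1) //.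
by apply: eq_bigr => k _; rewrite pp' // (leq_trans (bmdeg k.1)).
Qed.

Fact series_mulC : commutative series_mul.
Proof.
move=> f g; apply: mpseriesP => m.
by rewrite !(@series_mulE (mdeg m).+1) // mulrC.
Qed.

Fact series_mulA : associative series_mul.
Proof.
move=> f g h; apply: mpseriesP => m; set K := (mdeg m).+1.
rewrite !(@series_mulE K) //.
have trM (u v : mpseries n R) k : (mdeg k < K)%N ->
    (trunc K (series_mul u v))@_k = (trunc K u * trunc K v)@_k.
  by move=> kK; rewrite mcoeff_trunc // (series_mulE _ _ kK).
rewrite (mulrC (trunc K f)) (eq_mcoeffM _ (trM g h)) // mulrC mulrA.
by rewrite (eq_mcoeffM _ (trM f g)).
Qed.

Fact series_mul1 : left_id series_one series_mul.
Proof.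
move=> f; apply: mpseriesP => m; set K := (mdeg m).+1.
rewrite (@series_mulE K) // (@eq_mcoeffM K _ 1) ?mul1r ?mcoeff_trunc //.
by move=> k kK; rewrite mcoeff_trunc // mcoeff1.
Qed.

Fact series_mulDl : left_distributive series_mul +%R.
Proof.
move=> f g h; apply: mpseriesP => m /=; rewrite -big_split /=.
by apply: eq_bigr => k _; rewrite mulrDl.
Qed.

Fact series_one_neq0 : series_one != 0.
Proof.
apply/eqP => /(congr1 (fun f => scoeff f 0%MM)) /= /eqP.
by rewrite eqxx oner_eq0.
Qed.

HB.instance Definition _ := GRing.Zmodule_isComNzRing.Build (mpseries n R)
  series_mulA series_mulC series_mul1 series_mulDl series_one_neq0.

Fact series_of_mpoly_zmod : zmod_morphism series_of_mpoly.
Proof. by move=> p q; apply: mpseriesP => m /=; rewrite mcoeffB. Qed.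

Fact series_of_mpoly_monoid : monoid_morphism series_of_mpoly.
Proof.
split=> [|p q]; apply: mpseriesP => m /=; first by rewrite mcoeff1.
by rewrite (@mcoeff_poly_mul _ _ _ _ _ (mdeg m).+1).
Qed.

HB.instance Definition _ := GRing.isZmodMorphism.Build
  {mpoly R[n]} (mpseries n R) series_of_mpoly series_of_mpoly_zmod.
HB.instance Definition _ := GRing.isMonoidMorphism.Build
  {mpoly R[n]} (mpseries n R) series_of_mpoly series_of_mpoly_monoid.

(* The formal partial derivative with respect to x_i. *)
Definition spderiv (i : 'I_n) f : mpseries n R :=
  MPSeries (fun m => scoeff f (m + U_(i))%MM *+ (m i).+1).

(* spderivs [:: i_1; ...; i_r] f = d/dx_(i_1) ... d/dx_(i_r) f. *)
Definition spderivs (w : seq 'I_n) f : mpseries n R := foldr spderiv f w.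

End Ring.

Section IDomain.
Variable R : idomainType.
Implicit Types f g h : mpseries n R.

Definition series_unit : {pred mpseries n R} :=
  fun f => `[< exists g, g * f = 1 >].
Definition series_inv f : mpseries n R :=
  if pselect (exists g, g * f = 1) is left fU then projT1 (cid fU) else f.

Fact series_mulV : {in series_unit, left_inverse 1 series_inv *%R}.
Proof.
move=> f /asboolP fU; rewrite /series_inv.
by case: pselect => // {}fU; case: cid.
Qed.

Fact series_unitP f g : g * f = 1 -> series_unit f.
Proof. by move=> gf; apply/asboolP; exists g. Qed.

Fact series_inv_out : {in [predC series_unit], series_inv =1 id}.
Proof.
move=> f /asboolPn fNU; rewrite /series_inv.
by case: pselect => // fU; case: fNU.
Qed.

HB.instance Definition _ := GRing.ComNzRing_hasMulInverse.Build (mpseries n R)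
  series_mulV series_unitP series_inv_out.

Let least_monomial f : f != 0 ->
  exists2 a, scoeff f a != 0 & forall m, (m < a)%O -> scoeff f m = 0.
Proof.
move=> f0; apply: contrapT => noleast; case/eqP: f0.
apply: mpseriesP; apply: ltmwf => a IH /=.
by apply/eqP/negPn/negP => fa; apply: noleast; exists a.
Qed.

Fact series_integral : GRing.integral_domain_axiom (mpseries n R).
Proof.
move=> f g fg0; apply/negPn/negP; rewrite negb_or => /andP[f0 g0].
have [a fa a_min] := least_monomial f0.
have [b gb b_min] := least_monomial g0.
have /eqP := congr1 (fun h => scoeff h (a + b)%MM) fg0; apply/negP => /=.
have aK : (mdeg a < (mdeg (a + b)%MM).+1)%N by rewrite ltnS mdegD leq_addr.
have bK : (mdeg b < (mdeg (a + b)%MM).+1)%N by rewrite ltnS mdegD leq_addl.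
rewrite (bigD1 (BMultinom aK, BMultinom bK)) //= big1 ?addr0 ?mulf_neq0 //.
move=> [c d] /= /andP[/eqP abE cd].
have [ca|ac|caE] := ltgtP (bmnm c) a; first by rewrite a_min ?mul0r.
  have [db|bd] := ltP (bmnm d) b; first by rewrite b_min ?mulr0.
  by have := ltmc_le_add ac bd; rewrite -abE ltxx.
case/eqP: cd; congr (_, _); apply: val_inj => //=.
by move: abE; rewrite caE => /addmI.
Qed.

HB.instance Definition _ := GRing.ComUnitRing_isIntegral.Build (mpseries n R)
  series_integral.

End IDomain.
End Series.

Section Dfinite.
Variables (n : nat) (L : fieldType).

(* The field L(x_0, ..., x_(n-1)), as a subfield of the fraction field of
   L[[x_0, ..., x_(n-1)]]. *)
Definition is_ratfun (z : {fraction mpseries n L}) : Prop :=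
  exists p q : {mpoly L[n]}, q != 0 /\
    z = tofrac (series_of_mpoly p) / tofrac (series_of_mpoly q).

(* The L(x_0, ..., x_(n-1))-linear span of X. *)
Definition ratfun_span (X : set {fraction mpseries n L}) :
    set {fraction mpseries n L} :=
  [set v | exists (r : nat) (c u : 'I_r -> {fraction mpseries n L}),
     [/\ forall i, is_ratfun (c i), forall i, X (u i) &
         v = \sum_(i < r) c i * u i]].

Definition Dfinite (F : mpseries n L) : Prop :=
  exists s : seq {fraction mpseries n L},
    ratfun_span [set tofrac (spderivs w F) | w in [set: seq 'I_n]] =
    ratfun_span [set` s].

End Dfinite.

Definition in_quadrant (p : int * int) : bool := (0 <= p.1) && (0 <= p.2).

(* The walk (w_0, ..., w_l) with w_0 = p is encoded by its start p and the
   sequence [:: w_1; ...; w_l], following the convention of path. *)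
Definition quadrant_walks (S : {fset int * int}) (p q : int * int) (l : nat) :
    set (seq (int * int)) :=
  [set w | [/\ size w = l, path (fun u v => v - u \in S) p w,
               last p w = q & all in_quadrant (p :: w)]].

Lemma finite_quadrant_walks S p q l : finite_set (quadrant_walks S p q l).
Proof.
apply: (@sub_finite_set _ _
  [set w | size w = l /\ path (fun u v => v - u \in S) p w]).
  by move=> w [].
elim: l p => [|l IH] p.
  apply: (sub_finite_set _ (finite_set1 [::])) => w [/size0nil -> _] //.
apply: (@sub_finite_set _ _ (\bigcup_(s in [set` S])
    (cons (p + s) @`
      [set w | size w = l /\ path (fun u v => v - u \in S) (p + s) w]))).
  case=> [[]//|v w] [[szw] /= /andP[vS wS]].
  exists (v - p) => //; exists w; first by rewrite addrC subrK.
  by rewrite addrC subrK.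
apply: bigcup_finite => [|s _]; first exact: finite_fset.
exact: finite_image.
Qed.

(* fset_set yields the empty set on infinite sets, which is excluded by
   finite_quadrant_walks. *)
Definition nb_quadrant_walks (S : {fset int * int}) (p q : int * int)
    (l : nat) : nat := #|` fset_set (quadrant_walks S p q l)|.

(* The variables are ordered as x, y, t. *)
Definition quadrant_series (S : {fset int * int}) (i0 j0 : nat) :
    mpseries 3 rat :=
  MPSeries (fun m : 'X_{1..3} =>
    let i := m (@Ordinal 3 0 isT) in
    let j := m (@Ordinal 3 1 isT) in
    let l := m (@Ordinal 3 2 isT) in
    (nb_quadrant_walks S (i0%:Z, j0%:Z) (i%:Z, j%:Z) l)%:R).

(* Main.v *)
From HB Require Import structures.
Require Import Defs.
From mathcomp Require Import all_boot all_order all_algebra all_field.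
From mathcomp Require Import fraction finmap mpoly.
From mathcomp Require Import boolp classical_sets cardinality.
From mathcomp Require Import ring lra zify.

(** By the symmetry of the steps, the weighted enumeration of half-plane walks
    only involves [u = z + 1/z], where [z] marks the horizontal displacement.
    Let [g_n,j] in [Q[u]] be the enumeration of the walks of length [n] on the
    vertical half line that start at height [j0] and end at height [j], a
    step [(a, b)] having weight [1] if [a = 0] and [u / 2] otherwise, and let
    [U_i] be the Chebyshev polynomials: [u U_i = U_(i+1) + U_(i-1)].  If [rho]
    is the linear form on [Q[u]] for which the [U_i] are orthonormal, the number
    of quadrant walks from [(i0, j0)] to [(i, j)] is [rho (U_i0 U_i g_n,j)], so
    [Q = rho F] for a series [F] in [Q[u][[x, y, t]]].

    - [F] is algebraic over [Q(u, x, y, t)].  As [sum_i U_i x^i] is rational,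
      this reduces to [G_j0 = sum_(n, j) g_n,j y^j t^n], to which the kernel
      method applies: [K G_j = N_j] where [K] is an explicit polynomial and
      [N_j] is a polynomial in [y].  Since [G_0] is invertible, [N_0] divides
      [K] as a polynomial in [y], so its coefficients are algebraic; and
      [N_(j+1)] is a combination of [y N_j] and [N_0].
    - [rho] vanishes on the image of [T = (4 - u^2) d/du - 3 u], and [T] is
      injective on [Q[u]].  Counting dimensions as in Lipshitz's theorem on
      diagonals, [F] is annihilated by a nonzero operator in [d/dx] and [T] with
      coefficients in [Q[x, y, t]]: the elements [(d/dx)^a T^b F], [a, b < N],
      number [N^2], but they belong to a space of dimension [O(N)] over
      [Q(x, y, t)].  Dividing by a power of [T] and applying [rho] yields a
      differential equation in [x] for [Q].  The same holds for [y] and [t]. *)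

Set Implicit Arguments.
Unset Strict Implicit.
Unset Printing Implicit Defensive.

Import Order.TTheory GRing.Theory Num.Theory.
Local Open Scope ring_scope.

(** * Fractions and algebraic elements *)

Lemma fractionP (R : idomainType) (x : {fraction R}) :
  exists nd : R * R, nd.2 != 0 /\ x = tofrac nd.1 / tofrac nd.2.
Proof.
elim/quotW: x => x; exists (frac x); split; first exact: denom_ratioP.
rewrite -[_^-1]/(FracField.inv _) -[_ / _]/(FracField.mul _ _) !piE.
apply/eqmodP; rewrite /= FracField.equivfE.
by rewrite !numden_Ratio ?(oner_eq0, mulf_neq0, denom_ratioP) // !mulr1 mul1r mulrC.
Qed.

Lemma common_denominator (R : idomainType) (I : finType)
    (x : I -> {fraction R}) :
  exists (d : R) (n : I -> R), d != 0 /\ forall i, tofrac d * x i = tofrac (n i).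
Proof.
have /choice[nd ndP] := fun i => fractionP (x i).
exists (\prod_i (nd i).2), (fun i => (nd i).1 * \prod_(j | j != i) (nd j).2).
split=> [|i]; first by apply/prodf_neq0 => i _; case: (ndP i).
have [d0 ->] := ndP i; rewrite (bigD1 i) //= !tofracM.
by rewrite mulrC -mulrA mulKf ?tofrac_eq0.
Qed.

(** A rank count over the fraction field gives a nonzero kernel vector, and clearing denominators
    brings it back to [R]. *)
Lemma wide_kernel (R : idomainType) (m n : nat) (M : 'M[R]_(m, n)) :
  (n < m)%N -> exists2 v : 'rV[R]_m, v != 0 & v *m M = 0.
Proof.
move=> nm; pose MF := map_mx (@tofrac R) M.
have /rowV0Pn[w wker w0] : kermx MF != 0.
  by rewrite kermx_eq0 -row_leq_rank -ltnNge (leq_ltn_trans (rank_leq_col _)).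
have [d [v [d0 vE]]] := common_denominator (w 0).
have vw : map_mx (@tofrac R) (\row_i v i) = tofrac d *: w.
  by apply/rowP => i; rewrite !mxE vE.
exists (\row_i v i).
  apply: contra_neq w0 => v0; move/eqP: vw.
  by rewrite v0 map_mx0 eq_sym scaler_eq0 tofrac_eq0 (negPf d0) => /eqP.
have : map_mx (@tofrac R) (\row_i v i *m M) = 0.
  by rewrite map_mxM vw -scalemxAl (sub_kermxP wker) scaler0.
move/matrixP => vM; apply/matrixP => i j.
have := vM i j; rewrite [LHS]mxE [RHS]mxE => /eqP.
by rewrite tofrac_eq0 [X in _ -> _ = X]mxE => /eqP.
Qed.

Lemma sub_fraction (K : fieldType) (a b c d : K) : b != 0 -> d != 0 ->
  a / b - c / d = (a * d - c * b) / (b * d).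
Proof. by move=> b0 d0; field; apply/andP. Qed.

Definition is_algebraic (R K : nzRingType) (f : R -> K) (x : K) :=
  exists2 p, p != 0 & root (map_poly f p) x.

Section FractionLift.
Variables (R : idomainType) (E : fieldType) (f : {rmorphism R -> E}).
Hypothesis f_inj : injective f.

Lemma fraction_lift :
  exists g : {rmorphism {fraction R} -> E}, forall x, g (tofrac x) = f x.
Proof.
have f0 x : x != 0 -> f x != 0.
  by apply: contra_neq => fx; apply: f_inj; rewrite rmorph0.
have /choice[nd ndP] := @fractionP R.
pose g x := f (nd x).1 / f (nd x).2.
(* The value of [g] does not depend on the fraction representing [x], so each morphism law can be
   checked on a convenient representative. *)
have gE a b x : b != 0 -> x = tofrac a / tofrac b -> g x = f a / f b.
  move=> b0 xE; have [d0 dE] := ndP x; apply/eqP.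
  rewrite /g eqr_div ?f0 // -!rmorphM; apply/eqP; congr (f _); apply/eqP.
  by rewrite -tofrac_eq !tofracM -eqr_div ?tofrac_eq0 // -dE -xE.
have gB : zmod_morphism g.
  move=> x y; have [dx xE] := ndP x; have [dy yE] := ndP y.
  rewrite (gE ((nd x).1 * (nd y).2 - (nd y).1 * (nd x).2)
              ((nd x).2 * (nd y).2) (x - y)) ?mulf_neq0 //.
    by rewrite /g !rmorphB !rmorphM sub_fraction ?f0.
  by rewrite {1}xE {1}yE !rmorphB !rmorphM sub_fraction ?tofrac_eq0.
have gM : monoid_morphism g.
  split=> [|x y].
    by rewrite (gE 1 1) ?oner_eq0 ?rmorph1 ?divr1.
  have [dx xE] := ndP x; have [dy yE] := ndP y.
  rewrite (gE ((nd x).1 * (nd y).1) ((nd x).2 * (nd y).2)) ?mulf_neq0 //.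
    by rewrite /g !rmorphM mulf_div.
  by rewrite {1}xE {1}yE !rmorphM mulf_div.
pose ga := GRing.isZmodMorphism.Build _ _ g gB.
pose gm := GRing.isMonoidMorphism.Build _ _ g gM.
pose gr : {rmorphism {fraction R} -> E} := HB.pack g ga gm.
by exists gr => x; rewrite /= (gE x 1) ?oner_eq0 ?rmorph1 ?divr1.
Qed.

(** Multiplying a polynomial over the fraction field by a common denominator of its coefficients
    gives one over [R] with the same roots. *)
Lemma algebraic_fraction (g : {rmorphism {fraction R} -> E}) x :
  (forall x, g (tofrac x) = f x) ->
  algebraicOver g x <-> is_algebraic f x.
Proof.
move=> gE; split=> [[p p0 px]|[p p0 px]].
  have [d [n [d0 nE]]] := common_denominator (fun i : 'I_(size p) => p`_i).
  pose q := \poly_(i < size p) (if insub i is Some i' then n i' else 0).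
  have qE : map_poly (@tofrac R) q = tofrac d *: p.
    apply/polyP => i; rewrite coef_map coefZ coef_poly.
    case: insubP => [i' -> iE|/negPf iN]; first by rewrite /= -nE iE.
    by rewrite /= if_same rmorph0 nth_default ?mulr0 // leqNgt iN.
  exists q.
    apply: contra_neq p0 => q0; move/eqP: qE.
    by rewrite q0 rmorph0 eq_sym scaler_eq0 tofrac_eq0 (negPf d0) => /eqP.
  have -> : map_poly f q = map_poly g (map_poly (@tofrac R) q).
    by rewrite -map_poly_comp; apply: eq_map_poly => i; rewrite /= gE.
  by rewrite qE map_polyZ rootE hornerZ (eqP px) mulr0.
exists (map_poly (@tofrac R) p).
  by rewrite map_poly_eq0_id0 // tofrac_eq0 lead_coef_eq0.
rewrite -map_poly_comp; rewrite (eq_map_poly (g := f)) //.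
Qed.

End FractionLift.

Lemma irreducible_factor (F : fieldType) (p : {poly F}) :
  (1 < size p)%N -> exists2 q, irreducible_poly q & q %| p.
Proof.
move: {2}(size p) (leqnn (size p)) => n; elim: n p => [|n IH] p; first by case: size.
move=> pn p1; have [ip|] := pselect (irreducible_poly p); first by exists p.
move/not_andP => [//|/existsNP[q /not_implyP[q1 /not_implyP[qp /negP pq]]]].
have p0 : p != 0 by rewrite -size_poly_gt0 ltnW.
have q0 : q != 0 by apply: contraTneq qp => ->; rewrite dvd0p.
have qlt : (size q < size p)%N.
  rewrite ltn_neqAle dvdp_leq // andbT.
  by apply: contra pq => /eqP sqp; rewrite -dvdp_size_eqp // sqp.
have [||r ir rq] := IH q; first by rewrite -ltnS (leq_trans qlt).
  by rewrite ltn_neqAle eq_sym q1 size_poly_gt0.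
by exists r => //; apply: dvdp_trans rq qp.
Qed.

(** Induction on the degree with the field varying: adjoin a root of an irreducible factor, then
    split the cofactor over the larger field. *)
Lemma splitting_extension (F : fieldType) (p : {poly F}) : p != 0 ->
  exists (E : fieldType) (f : {rmorphism F -> E}) (s : seq E),
    map_poly f p %= \prod_(z <- s) ('X - z%:P).
Proof.
move: {2}(size p) (leqnn (size p)) => n; elim: n F p => [|n IH] F p.
  by rewrite leqn0 size_poly_eq0 => ->.
move=> pn p0; have [p1|p1] := leqP (size p) 1.
  exists F, idfun, [::]; rewrite map_poly_id // big_nil.
  by rewrite -size_poly_eq1 eqn_leq p1 size_poly_gt0.
have [q iq qp] := irreducible_factor p1.
have [L _ [z qz _]] := irredp_FAdjoin iq.
pose j : {rmorphism F -> L} := in_alg L.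
have /factor_theorem[r rE] : root (map_poly j p) z.
  by move: qz; rewrite -!dvdp_XsubCl => /dvdp_trans -> //; rewrite dvdp_map.
have r0 : r != 0.
  by apply: contra_neq p0 => r0; apply/eqP; rewrite -(map_poly_eq0 j) rE r0 mul0r.
have [|E [f [s fs]]] := IH L r _ r0.
  by rewrite -ltnS (leq_trans _ pn) // -(size_map_poly j p) rE size_Mmonic
    ?monicXsubC // size_XsubC addn2.
exists E, (f \o j), (f z :: s).
rewrite map_poly_comp rE rmorphM /= rmorphB /= map_polyX map_polyC big_cons /=.
by rewrite mulrC eqp_mul2l // polyXsubC_eq0.
Qed.

Lemma algebraic_prod_XsubC (F E : fieldType) (f : {rmorphism F -> E})
    (s : seq E) : (forall z, z \in s -> algebraicOver f z) ->
  forall i, algebraicOver f (\prod_(z <- s) ('X - z%:P))`_i.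
Proof.
elim: s => [_|z s IH sA] i.
  rewrite big_nil coef1; case: eqP => _; [exact: algebraic1 | exact: algebraic0].
have zA : algebraicOver f z by apply: sA; rewrite inE eqxx.
have {}IH := IH (fun y ys => sA y (mem_behead (s := z :: s) ys)).
rewrite big_cons mulrBl coefB coefXM coefCM; apply: algebraic_sub.
  by case: eqP => // _; [exact: algebraic0].
exact: algebraic_mul.
Qed.

(* The roots of a factor of [p] are roots of [p]. *)
Lemma algebraic_monic_factor (F K : fieldType) (f : {rmorphism F -> K})
    (p q : {poly K}) : p != 0 -> q \is monic -> q %| p ->
  (forall i, algebraicOver f p`_i) -> forall i, algebraicOver f q`_i.
Proof.
move=> p0 q1 qp pA i.
have [E [h [s ps]]] := splitting_extension p0.
have hA x : algebraicOver f x -> algebraicOver (h \o f) (h x).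
  move=> [r r0 rx]; exists r => //.
  by rewrite map_poly_comp rootE horner_map (eqP rx) rmorph0.
have sA z : z \in s -> algebraicOver (h \o f) z.
  move=> zs; apply/integral_algebraic.
  apply: (@integral_root _ _ _ (map_poly h p)).
  - by rewrite map_poly_eq0.
  - by rewrite (eqp_root ps) root_prod_XsubC.
  - move=> _ /(nthP 0)[k _ <-]; apply/integral_algebraic.
    by rewrite coef_map; apply/hA/pA.
have [m qm] : {m | map_poly h q %= \prod_(z <- mask m s) ('X - z%:P)}.
  by apply: dvdp_prod_XsubC; rewrite -(eqp_dvdr _ ps) dvdp_map.
have {}qm : map_poly h q = \prod_(z <- mask m s) ('X - z%:P).
  by apply/eqP; rewrite -eqp_monic ?map_monic ?monic_prod_XsubC.
have : algebraicOver (h \o f) (h q`_i).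
  rewrite -coef_map qm; apply: algebraic_prod_XsubC => z /mem_mask.
  exact: sA.
case=> r r0; rewrite map_poly_comp rootE horner_map fmorph_eq0 => rq.
by exists r.
Qed.

Lemma fraction_morphism (R A : idomainType) (f : {rmorphism R -> A}) :
  injective f -> exists g : {rmorphism {fraction R} -> {fraction A}},
    (forall x, g (tofrac x) = tofrac (f x)) /\
    (forall y, algebraicOver g (tofrac y) -> is_algebraic f y).
Proof.
move=> f_inj; have ff_inj : injective (@tofrac A \o f).
  by move=> x y /= /eqP; rewrite tofrac_eq => /eqP /f_inj.
have [g gE] := fraction_lift ff_inj; exists g; split=> // y.
move/(algebraic_fraction _ gE) => [p p0 py]; exists p => //.
move: py; rewrite map_poly_comp rootE horner_map /= => /eqP/eqP.
by rewrite tofrac_eq0.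
Qed.

(** Dividing by a monic polynomial only adds, negates and multiplies coefficients. It is applied to
    the series free of [y]. *)
Lemma closed_monic_division (A : comNzRingType) (C : A -> Prop) (d p : {poly A}) :
  C 0 -> (forall x y, C x -> C y -> C (x + y)) -> (forall x, C x -> C (- x)) ->
  (forall x y, C x -> C y -> C (x * y)) ->
  d \is monic -> (forall i, C d`_i) -> (forall i, C p`_i) ->
  exists q r, [/\ p = q * d + r, (size r < size d)%N, 
    forall i, C q`_i & forall i, C r`_i].
Proof.
move=> C0 CD CN CM dm dC.
move: {2}(size p) (leqnn (size p)) => n; elim: n p => [|n IH] p pn pC.
  exists 0, p; split=> // [||i]; rewrite ?mul0r ?add0r ?coef0 //.
  by rewrite (leq_ltn_trans pn) // size_poly_gt0 monic_neq0.
have [pd|dp] := ltnP (size p) (size d).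
  by exists 0, p; split=> // [|i]; rewrite ?mul0r ?add0r ?coef0.
set e := (size p - size d)%N; set c := lead_coef p.
have cC : C c by rewrite /c lead_coefE.
have cdC i : C (c *: 'X^e * d)`_i.
  rewrite -scalerAl coefZ coefXnM; apply: (CM) => //.
  by case: ifP => // _.
have size_p1 : (size (p - c *: 'X^e * d)%R <= n)%N.
  have d0 : (0 < size d)%N by rewrite size_poly_gt0 monic_neq0.
  apply/leq_sizeP => j nj; rewrite coefB -scalerAl coefZ coefXnM.
  have sp : size p = ((size d).-1 + e).+1 by rewrite -addSn prednK // subnKC.
  case: ltnP => je; first exfalso.
    by move: (leq_ltn_trans nj je); rewrite ltnNge -ltnS (leq_trans _ pn) // sp ltnS leq_addl.
  have [jp|jp] := leqP (size p) j.
    by rewrite !nth_default ?mulr0 ?subr0 // leq_subRL // addnC -(prednK d0) addSn -sp.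
  have jE : j = (size p).-1.
    by apply/eqP; rewrite eqn_leq -ltnS prednK ?jp 1?sp //= -ltnS -sp (leq_trans pn).
  have -> : (j - e = (size d).-1)%N by rewrite jE sp addnK.
  by rewrite -lead_coefE (monicP dm) mulr1 /c lead_coefE jE subrr.
have [|q [r [E rd qC rC]]] := IH _ size_p1.
  by move=> i; rewrite coefB; apply: CD => //; apply: CN.
exists (c *: 'X^e + q), r; split=> //.
  by rewrite mulrDl -addrA -E addrC subrK.
by move=> i; rewrite coefD coefZ coefXn; apply: CD => //; case: eqP => _; rewrite ?mulr1 ?mulr0.
Qed.

(** What the kernel method uses about algebraic elements, with the base ring hidden. Since [A] is
    only a domain, division takes the form of the cancellation [alg_cancel]. *)
Record algebraically_closed_in (A : idomainType) (alg : A -> Prop) : Prop := {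
  alg1 : alg 1;
  algB : forall x y, alg x -> alg y -> alg (x - y);
  algM : forall x y, alg x -> alg y -> alg (x * y);
  alg_cancel : forall x y, x != 0 -> alg x -> alg (x * y) -> alg y;
  alg_factor : forall p q : {poly A}, p != 0 -> q \is monic ->
    (exists r, p = r * q) -> (forall i, alg p`_i) -> forall i, alg q`_i }.

Section AlgebraicClosed.
Variables (A : idomainType) (alg : A -> Prop).
Hypothesis algA : algebraically_closed_in alg.

Lemma alg0 : alg 0.
Proof. by rewrite -(subrr 1); apply: (algB algA); apply: (alg1 algA). Qed.

Lemma algD x y : alg x -> alg y -> alg (x + y).
Proof.
move=> xa ya; rewrite -[y]opprK; apply: (algB algA) => //.
by rewrite -[- y]sub0r; apply: (algB algA) => //; exact: alg0.
Qed.

Lemma algX x n : alg x -> alg (x ^+ n).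
Proof.
move=> xa; elim: n => [|n IH]; first by rewrite expr0; exact: (alg1 algA).
by rewrite exprS; apply: (algM algA).
Qed.

Lemma alg_sum (I : Type) (s : seq I) (P : pred I) (x : I -> A) :
  (forall i, P i -> alg (x i)) -> alg (\sum_(i <- s | P i) x i).
Proof.
by move=> xa; elim/big_rec: _ => [|i z Pi za]; [exact: alg0 | apply: algD; [exact: xa|]].
Qed.

End AlgebraicClosed.

(** Each fact is transferred from the extension of fraction fields, where algebraic elements form a
    field. *)
Lemma algebraic_closed (R A : idomainType) (f : {rmorphism R -> A}) :
  injective f -> algebraically_closed_in (is_algebraic f).
Proof.
move=> f_inj; have [g [gE gA]] := fraction_morphism f_inj.
have Ag y : is_algebraic f y -> algebraicOver g (tofrac y).
  move=> [p p0 py]; exists (map_poly (@tofrac R) p).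
    by rewrite map_poly_eq0_id0 // tofrac_eq0 lead_coef_eq0.
  rewrite -map_poly_comp (eq_map_poly (g := @tofrac A \o f)) // map_poly_comp.
  by rewrite rootE horner_map (eqP py) rmorph0.
split=> [|x y /Ag xa /Ag ya|x y /Ag xa /Ag ya|x y x0 /Ag xa /Ag xya|p q p0 qm [r pE] pA i].
- by apply: gA; rewrite tofrac1; exact: algebraic1.
- by apply: gA; have := algebraic_sub xa ya; rewrite -tofracB.
- by apply: gA; have := algebraic_mul xa ya; rewrite -tofracM.
- apply: gA; move: xya; rewrite tofracM => xya.
  have := algebraic_div xya xa; by rewrite mulrC mulKf ?tofrac_eq0.
- apply: gA; rewrite -coef_map.
  apply: (@algebraic_monic_factor _ _ g (map_poly (@tofrac A) p)).
  + by rewrite map_poly_eq0_id0 ?tofrac_eq0 ?lead_coef_eq0.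
  + exact: monic_map.
  + by rewrite pE rmorphM dvdp_mull.
  + by move=> j; rewrite coef_map; apply/Ag/pA.
Qed.

Lemma is_algebraic_image (R A : nzRingType) (f : {rmorphism R -> A}) x :
  is_algebraic f (f x).
Proof.
exists ('X - x%:P); first by rewrite polyXsubC_eq0.
by rewrite rmorphB /= map_polyX map_polyC root_XsubC.
Qed.

(** * Elimination *)

Section Elimination.
Variables (S A : idomainType) (phi : {rmorphism {poly S} -> A}).
Hypothesis phi_inj : injective phi.
Hypothesis S_char0 : forall n, n.+1%:R != 0 :> S.
Implicit Types (d : A -> A) (P Q : {poly {poly S}}).

Definition derivation d :=
  {morph d : x y / x + y} /\ (forall x y, d (x * y) = d x * y + x * d y).

(** The size bound forbids growth of the degree in the variable to be eliminated, which keeps the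
    dimension count linear. *)
Definition lifts d :=
  forall p : {poly S}, exists2 q : {poly S}, (size q <= size p)%N & d (phi p) = phi q.

Lemma derivation0 d : derivation d -> d 0 = 0.
Proof. by case=> dD _; apply: (addrI (d 0)); rewrite -dD !addr0. Qed.

Lemma derivation_sum d (I : finType) (f : I -> A) :
  derivation d -> d (\sum_i f i) = \sum_i d (f i).
Proof. by move=> dd; apply: (big_morph d dd.1 (derivation0 dd)). Qed.

Lemma derivationX d x n : derivation d -> d (x ^+ n.+1) = d x * x ^+ n *+ n.+1.
Proof.
case=> _ dM; elim: n => [|n IH]; first by rewrite expr0 mulr1 expr1.
by rewrite exprS dM IH exprS; ring.
Qed.

Variable F : A.

Let ev : {rmorphism {poly {poly S}} -> A} := horner_eval F \o map_poly phi.

Let evC c : ev c%:P = phi c.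
Proof. by rewrite /= /horner_eval map_polyC hornerC. Qed.

Let evX : ev 'X = F.
Proof. by rewrite /= /horner_eval map_polyX hornerX. Qed.

Let evE P n : (size P <= n)%N -> ev P = \sum_(i < n) phi P`_i * F ^+ i.
Proof.
move=> Pn; rewrite /= /horner_eval (@horner_coef_wide _ n).
  by apply: eq_bigr => i _; rewrite coef_map.
by rewrite (leq_trans (size_poly _ _)).
Qed.

Let d_ev d P : derivation d -> lifts d ->
  exists Q, d (ev P) = ev Q + ev P^`() * d F.
Proof.
move=> dd dl; elim/poly_ind: P => [|P c [Q IH]].
  by exists 0; rewrite deriv0 rmorph0 (derivation0 dd) mul0r addr0.
have [c' _ cE] := dl c; exists (Q * 'X + c'%:P).
rewrite derivD derivM derivC derivX addr0 mulr1 !(rmorphD, rmorphM) dd.1 dd.2.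
by rewrite evX !evC IH cE; ring.
Qed.

Lemma minimal_relation : is_algebraic phi F ->
  exists P, [/\ P != 0, ev P = 0 &
    forall Q, Q != 0 -> ev Q = 0 -> (size P <= size Q)%N].
Proof.
case=> P P0 /rootP PF; have {PF} : ev P = 0 by [].
move: {2}(size P) (leqnn (size P)) => n; elim: n P P0 => [|n IH] P P0 Pn PF.
  by move: Pn; rewrite leqn0 size_poly_eq0 (negPf P0).
have [minP|] := pselect (forall Q, Q != 0 -> ev Q = 0 -> (size P <= size Q)%N).
  by exists P.
move=> /existsNP[Q /not_implyP[Q0 /not_implyP[QF /negP]]]; rewrite -ltnNge => QP.
by apply: (IH Q) => //; rewrite -ltnS (leq_trans QP).
Qed.

(** Differentiating [P(F) = 0] expresses [P'(F) * d F] as a polynomial in [F]. If [D = U P + V P'],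
    multiplying by [V(F)] replaces the factor [P'(F)] by [D], which is the same for all
    derivations. *)
Lemma deriv_algebraic : is_algebraic phi F ->
  exists2 D : {poly S}, D != 0 & forall d, derivation d -> lifts d ->
    exists Q, phi D * d F = ev Q.
Proof.
move=> /minimal_relation[P [P0 PF Pmin]].
have P1 : (1 < size P)%N.
  rewrite ltnNge; apply/negP => /size1_polyC PE; move: PF P0.
  rewrite PE evC -(rmorph0 phi) => /phi_inj ->.
  by rewrite polyC0 eqxx.
have P'0 : P^`() != 0.
  have : P^`()`_(size P).-2 != 0.
    rewrite coef_deriv; have -> : (size P).-2.+1 = (size P).-1 by lia.
    rewrite -mulr_natr mulf_neq0 -?lead_coefE ?lead_coef_eq0 //.
    have -> : (size P).-1 = (size P).-2.+1 by lia.
    by rewrite -polyC_natr polyC_eq0 S_char0.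
  by apply: contra_neq => ->; rewrite coef0.
suff [D D0 [U [V UV]]] : exists2 D : {poly S}, D != 0 &
    exists U V, D%:P = U * P + V * P^`().
  exists D => // d dd dl; have [Q QE] := d_ev P dd dl.
  exists (- (V * Q)); rewrite -evC UV rmorphD rmorphN !rmorphM PF mulr0.
  move/eqP: QE; rewrite PF (derivation0 dd) eq_sym addrC addr_eq0 => /eqP QE.
  by rewrite add0r -mulrA QE mulrN.
(* When [P'] is constant it serves as [D] itself; otherwise [D] is the resultant of [P] and [P']. *)
have [P'1|P'1] := leqP (size P^`()) 1.
  have PE := size1_polyC P'1; exists P^`()`_0.
    by apply: contra_neq P'0 => c0; rewrite PE c0.
  by exists 0, 1; rewrite mul0r add0r mul1r -PE.
have [[U V] _ /= UV] := resultant_in_ideal P1 P'1.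
exists (resultant P P^`()); last by exists U, V.
(* A zero resultant gives a nonconstant common divisor [g]. Then [F] is a root of [g] or of its
   cofactor [h], both smaller than the minimal [P]. *)
rewrite resultant_eq0 -leqNgt leqNgt; apply/negP => g1.
set g := gcdp P P^`() in g1.
have g0 : g != 0 by rewrite -size_poly_gt0 ltnW.
have gP : g %| P by exact: dvdp_gcdl.
have gP' : g %| P^`() by exact: dvdp_gcdr.
have gs : (size g < size P)%N.
  by apply: leq_ltn_trans (lt_size_deriv P0); exact: dvdp_leq.
move: gP; rewrite Pdiv.Idomain.dvdp_eq; set h := _ %/ _ => /eqP gh.
have h0 : h != 0.
  apply: contra_neq P0 => h0; move/eqP: gh; rewrite h0 mul0r -mul_polyC mulf_eq0.
  by rewrite polyC_eq0 expf_eq0 lead_coef_eq0 (negPf g0) andbF => /eqP.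
have hs : (size h + size g = (size P).+1)%N.
  have := congr1 (fun p : {poly {poly S}} => size p) gh.
  rewrite size_scale ?expf_neq0 ?lead_coef_eq0 // size_mul // => ->.
  by rewrite prednK // addn_gt0 size_poly_gt0 h0.
have : ev h * ev g = 0 by rewrite -rmorphM -gh -mul_polyC rmorphM PF mulr0.
move/eqP; rewrite mulf_eq0 => /orP[]/eqP e0.
  have := Pmin h h0 e0; rewrite leqNgt -[(_ < _)%N]ltnS -hs.
  by rewrite -addn1 ltn_add2l g1.
by have := Pmin g g0 e0; rewrite leqNgt gs.
Qed.

Let reduces E (D : {poly S}) x :=
  exists b : 'I_E -> {poly S}, phi D * x = \sum_m phi (b m) * F ^+ m.

Let reducesMl E (D D' : {poly S}) x : reduces E D x -> reduces E (D' * D) x.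
Proof.
move=> [b bE]; exists (fun m => D' * b m).
rewrite rmorphM -mulrA bE mulr_sumr.
by apply: eq_bigr => m _; rewrite rmorphM mulrA.
Qed.

Let reduce_powers E (D : {poly S}) d :
  (forall Q, exists2 c : {poly S}, c != 0 & reduces E c (ev Q)) ->
  D != 0 -> (exists Q, phi D * d F = ev Q) -> derivation d ->
  exists2 D' : {poly S}, D' != 0 & forall l, (l < E)%N -> reduces E D' (d (F ^+ l)).
Proof.
move=> red D0 [Q QE] dd; elim: {1}E => [|n [D' D'0 IH]].
  by exists 1; rewrite ?oner_eq0.
have [c c0 rc] : exists2 c : {poly S}, c != 0 & reduces E c (d (F ^+ n)).
  case: n {IH} => [|n].
    exists 1; first exact: oner_neq0.
    exists (fun=> 0); rewrite rmorph1 mul1r big1 => [|m _]; last by rewrite rmorph0 mul0r.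
    apply: (addrI (d 1)); rewrite expr0 addr0 -[in RHS](mulr1 1) dd.2.
    by rewrite mulr1 mul1r.
  have [c c0 [b bE]] := red (Q * 'X ^+ n *+ n.+1).
  exists (c * D); first exact: mulf_neq0.
  exists b; rewrite -bE derivationX // !(rmorphMn, rmorphM, rmorphXn) evX -QE /=.
  by ring.
exists (c * D'); first exact: mulf_neq0.
move=> l; rewrite ltnS leq_eqVlt => /predU1P[->|ln].
  by rewrite mulrC; apply: reducesMl.
exact/reducesMl/IH.
Qed.

(** Pseudo-division by a minimal relation [P] bounds the powers of [F]. Taking [E = size P] rather
    than the degree ensures [1 < E], so that [F] is itself one of the powers. *)
Lemma common_reduction d1 d2 : is_algebraic phi F ->
  derivation d1 -> lifts d1 -> derivation d2 -> lifts d2 ->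
  exists E (D : {poly S}), [/\ (1 < E)%N, D != 0,
   forall l, (l < E)%N -> reduces E D (d1 (F ^+ l)) &
   forall l, (l < E)%N -> reduces E D (d2 (F ^+ l))].
Proof.
move=> Falg dd1 dl1 dd2 dl2.
have [P [P0 PF Pmin]] := minimal_relation Falg.
have [D D0 DP] := deriv_algebraic Falg.
have P1 : (1 < size P)%N.
  rewrite ltnNge; apply/negP => /size1_polyC PE; move: PF P0.
  rewrite PE evC -(rmorph0 phi) => /phi_inj ->.
  by rewrite polyC0 eqxx.
have red Q : exists2 c : {poly S}, c != 0 & reduces (size P) c (ev Q).
  exists (lead_coef P ^+ scalp Q P); first by rewrite expf_neq0 // lead_coef_eq0.
  exists (fun m => (Q %% P)`_m).
  rewrite -(evE (ltnW _)) ?ltn_modp // -evC -rmorphM mul_polyC.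
  by rewrite (Pdiv.Idomain.divp_eq Q P) rmorphD rmorphM PF mulr0 add0r.
have [D1 D10 r1] := reduce_powers red D0 (DP d1 dd1 dl1) dd1.
have [D2 D20 r2] := reduce_powers red D0 (DP d2 dd2 dl2) dd2.
exists (size P), (D1 * D2); split=> //; first exact: mulf_neq0.
  by move=> l lP; rewrite mulrC; apply/reducesMl/r1.
by move=> l lP; apply/reducesMl/r2.
Qed.

Section Levels.
Variables (E : nat) (D : {poly S}) (c : nat).

(* The filtration of the module spanned by the powers of [F], localized at [D],
   by pole order and degree. *)
Let level n f := exists p : 'I_E -> {poly S},
  (forall m, (size (p m) <= c * n.+1)%N) /\
  phi D ^+ n * f = \sum_m phi (p m) * F ^+ m.

Lemma level_self : (1 < E)%N -> (0 < c)%N -> level 0 F.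
Proof.
move=> E1 c0; exists (fun m => (val m == 1%N)%:R%:P); split=> [m|].
  by rewrite muln1 (leq_trans (size_polyC_leq1 _)).
rewrite expr0 mul1r (bigD1 (Ordinal E1)) //= rmorph1 mul1r big1 ?addr0 // => m.
by rewrite -val_eqE /= => /negPf ->; rewrite polyC0 rmorph0 mul0r.
Qed.

Lemma level_leq n n' f : (size D <= c)%N -> (n <= n')%N -> level n f -> level n' f.
Proof.
move=> Dc nn' fn; rewrite -(subnKC nn'); elim: (_ - _)%N => [|k [p [ps pE]]].
  by rewrite addn0.
exists (fun m => D * p m); split=> [m|].
  rewrite (leq_trans (size_polyMleq _ _)) //.
  by have := ps m; nia.
rewrite addnS exprS -mulrA pE mulr_sumr.
by apply: eq_bigr => m _; rewrite rmorphM mulrA.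
Qed.

(** By the Leibniz rule, [D^(n+1) * d f = D * d (D^n * f) - n * d D * (D^n * f)]: a first-order
    operator raises the pole order by one and the degree by at most [c]. *)
Lemma level_deriv d (g h : {poly S}) n f : derivation d -> lifts d ->
  (forall l, (l < E)%N -> exists2 b : 'I_E -> {poly S},
     forall m, (size g + size (b m) <= c)%N &
     phi D * d (F ^+ l) = \sum_m phi (b m) * F ^+ m) ->
  (size g + size D <= c)%N -> (size h + size D <= c)%N ->
  level n f -> level n.+1 (phi g * d f + phi h * f).
Proof.
move=> dd dl red gD hD [p [ps pE]].
have /choice[b bP] : forall l, exists b : 'I_E -> {poly S}, (l < E)%N ->
    (forall m, (size g + size (b m) <= c)%N) /\
     phi D * d (F ^+ l) = \sum_m phi (b m) * F ^+ m.
  move=> l; case: (ltnP l E) => lE; last by exists (fun=> 0).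
  by have [b b1 b2] := red l lE; exists b.
have /choice[p' p'P] : forall m, exists q : {poly S},
    (size q <= size (p m))%N /\ d (phi (p m)) = phi q.
  by move=> m; have [q ? ?] := dl (p m); exists q.
have [D' D's D'E] : exists2 D' : {poly S}, (size D' <= size D)%N & d (phi D) = phi D'.
  exact: dl.
exists (fun m => g * (D * p' m + \sum_l p l * b l m - (D' * p m) *+ n) + h * (D * p m)).
split=> [m|].
  have mulB (x y : {poly S}) a e : (size x <= a)%N -> (size y <= e)%N ->
      (size (x * y)%R <= a + e)%N.
    move=> xa ye; rewrite (leq_trans (size_polyMleq _ _)) //.
    by rewrite (leq_trans (leq_pred _)) // leq_add.
  have addB (x y : {poly S}) a : (size x <= a)%N -> (size y <= a)%N ->
      (size (x + y)%R <= a)%N.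
    by move=> xa ya; rewrite (leq_trans (size_polyD _ _)) // geq_max xa.
  have pm := ps m; have [p'm _] := p'P m.
  apply: (addB); last first.
    rewrite (leq_trans (mulB _ _ _ _ (leqnn _) (mulB _ _ _ _ (leqnn _) pm))) //.
    by nia.
  have -> : (c * n.+2 = size g + (c * n.+2 - size g))%N.
    by rewrite subnKC //; nia.
  apply: (mulB) => //; apply: (addB); [apply: (addB) | rewrite size_polyN].
  - rewrite (leq_trans (mulB _ _ _ _ (leqnn _) (leq_trans p'm pm))) //.
    by nia.
  - apply: (leq_trans (size_sum _ _ _)); apply/bigmax_leqP => l _.
    rewrite (leq_trans (mulB _ _ _ _ (ps l) (leqnn _))) //.
    by have [/(_ m) bm _] := bP l (ltn_ord l); nia.
  - rewrite -mulr_natl -polyC_natr mul_polyC (leq_trans (size_scale_leq _ _)) //.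
    by rewrite (leq_trans (mulB _ _ _ _ D's pm)) //; nia.
have dpE : phi D ^+ n.+1 * d f = phi D * d (phi D ^+ n * f)
    - phi D' * (phi D ^+ n * f) *+ n.
  rewrite dd.2; case: (n) => [|k].
    have -> : d (phi D ^+ 0) = 0.
      apply: (addrI (d 1)); rewrite expr0 addr0 -[in RHS](mulr1 1) dd.2.
      by rewrite mulr1 mul1r.
    by rewrite expr0 expr1 mul0r add0r mul1r mulr0n subr0.
  by rewrite derivationX // D'E !exprS; ring.
have -> : phi D ^+ n.+1 * (phi g * d f + phi h * f) =
    phi g * (phi D * d (phi D ^+ n * f) - phi D' * (phi D ^+ n * f) *+ n) +
    phi h * (phi D * (phi D ^+ n * f)).
  by rewrite -dpE exprS; ring.
rewrite pE; have -> : phi D * d (\sum_m phi (p m) * F ^+ m) =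
   \sum_m phi (D * p' m + \sum_l p l * b l m) * F ^+ m.
  rewrite derivation_sum // mulr_sumr; under [RHS]eq_bigr => m _ do
    rewrite rmorphD rmorphM mulrDl rmorph_sum mulr_suml.
  rewrite big_split exchange_big -big_split; apply: eq_bigr => l _ /=.
  have [_ blE] := bP l (ltn_ord l); have [_ plE] := p'P l.
  rewrite dd.2 mulrDr plE mulrA mulrCA blE mulr_sumr; congr (_ + _).
  by apply: eq_bigr => m _; rewrite rmorphM mulrA.
rewrite !mulr_sumr -sumrMnl -sumrB !mulr_sumr -big_split; apply: eq_bigr => m _ /=.
rewrite !(rmorphD, rmorphM, rmorphN, rmorphMn) /=.
by ring.
Qed.

End Levels.

Lemma algebraic_elimination d1 d2 (g h : {poly S}) : is_algebraic phi F ->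
  derivation d1 -> lifts d1 -> derivation d2 -> lifts d2 ->
  let T f := phi g * d2 f + phi h * f in
  exists N (v : 'I_N -> 'I_N -> S), (exists a b, v a b != 0) /\
    \sum_a \sum_b phi (v a b)%:P * iter a d1 (iter b T F) = 0.
Proof.
move=> Falg dd1 dl1 dd2 dl2 T.
have [E [D [E1 D0 r1 r2]]] := common_reduction Falg dd1 dl1 dd2 dl2.
have [c [c0 Dc lev]] : exists c, [/\ (0 < c)%N, (size D <= c)%N &
  let level n f := exists p : 'I_E -> {poly S},
     (forall m, (size (p m) <= c * n.+1)%N) /\
     phi D ^+ n * f = \sum_m phi (p m) * F ^+ m in
  [/\ level 0%N F,
    forall n n' f, (n <= n')%N -> level n f -> level n' f,
    forall n f, level n f -> level n.+1 (d1 f) &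
    forall n f, level n f -> level n.+1 (T f)]].
  have /choice[b1 b1P] := fun l : 'I_E => r1 l (ltn_ord l).
  have /choice[b2 b2P] := fun l : 'I_E => r2 l (ltn_ord l).
  (* A sum of all the sizes involved dominates each bound required by the lemmas on levels. *)
  pose c := (1 + size D + size g + size h + \sum_l \sum_m (size (b1 l m) + size (b2 l m)))%N.
  have bc l m : (size (b1 l m) + size (b2 l m) <= \sum_l \sum_m (size (b1 l m) + size (b2 l m)))%N.
    by rewrite (bigD1 l) //= (bigD1 m) //= -addnA leq_addr.
  exists c; split; rewrite /c; [lia | lia |]; split.
  - by apply: level_self => //; lia.
  - by move=> n n' f; apply: level_leq; lia.
  - move=> n f lf; have -> : d1 f = phi 1 * d1 f + phi 0 * f.
      by rewrite rmorph1 rmorph0 mul1r mul0r addr0.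
    apply: level_deriv => //; rewrite ?size_poly1 ?size_poly0; try lia.
    move=> l lE; exists (b1 (Ordinal lE)) => [m|]; last exact: b1P (Ordinal lE).
    by have := bc (Ordinal lE) m; lia.
  - move=> n f lf; apply: level_deriv => //; try lia.
    move=> l lE; exists (b2 (Ordinal lE)) => [m|]; last exact: b2P (Ordinal lE).
    by have := bc (Ordinal lE) m; lia.
move: lev => /= [lev0 levle lev1 levT].
(* The [N^2] elements lie in level [2N], described by [E * Z = E c (2N + 1)] coefficients in [S];
   [N > 3 E c] makes [N^2] larger. *)
pose N := (3 * E * c).+1; pose Z := (c * (N + N).+1)%N.
have wlev (a b : 'I_N) : exists p : 'I_E -> {poly S},
   (forall m, (size (p m) <= Z)%N) /\
   phi D ^+ (N + N) * iter a d1 (iter b T F) = \sum_m phi (p m) * F ^+ m.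
  apply: (levle (a + b)%N); first by have := ltn_ord a; have := ltn_ord b; lia.
  elim: (nat_of_ord a) => [|a' IH]; last exact: lev1.
  by elim: (nat_of_ord b) => [|b' IH]; [|exact: levT].
have /choice[p pP] := fun ab : 'I_N * 'I_N => wlev ab.1 ab.2.
(* Rows are the pairs [(a, b)]; columns are a power of [F] and an exponent of the eliminated
   variable. A left kernel vector over [S] is thus a relation free of that variable. *)
pose M := \matrix_(r < #|{: 'I_N * 'I_N}|, k < #|{: 'I_E * 'I_Z}|)
  (p (enum_val r) (enum_val k).1)`_(enum_val k).2.
have [|v v0 vM] := @wide_kernel _ _ _ M.
  rewrite !card_prod !card_ord /Z /N; nia.
exists N, (fun a b => v 0 (enum_rank (a, b))); split.
  have /existsP[r vr] : [exists r, v 0 r != 0].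
    apply: contra_neqT v0; rewrite negb_exists => /forallP v0.
    by apply/rowP => r; rewrite mxE; apply/eqP; have := v0 r; rewrite negbK.
  by exists (enum_val r).1, (enum_val r).2; rewrite -surjective_pairing enum_valK.
have D0' : phi D ^+ (N + N) != 0.
  rewrite expf_neq0 //; apply: contra_neq D0 => D0.
  by apply: phi_inj; rewrite rmorph0.
apply/(mulfI D0'); rewrite mulr0 pair_big mulr_sumr /=.
under eq_bigr => ab _.
  rewrite mulrCA (pP ab).2 mulr_sumr -surjective_pairing.
  under eq_bigr => m _ do rewrite mulrA -rmorphM.
  over.
rewrite exchange_big big1 // => m _; rewrite -mulr_suml -rmorph_sum.
suff -> : \sum_ab (v 0 (enum_rank ab))%:P * p ab m = 0 by rewrite rmorph0 mul0r.
apply/polyP => k; rewrite coef0 coef_sum.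
have [Zk|kZ] := leqP Z k.
  rewrite big1 // => ab _; rewrite coefCM nth_default ?mulr0 //.
  exact: leq_trans ((pP ab).1 m) Zk.
have /matrixP/(_ 0 (enum_rank (m, Ordinal kZ))) := vM.
rewrite [LHS]mxE [RHS]mxE => vMk; rewrite -[RHS]vMk.
rewrite (reindex (fun r : 'I_#|{: 'I_N * 'I_N}| => enum_val r)) /=; last first.
  by apply: onW_bij; apply: enum_val_bij.
by apply: eq_bigr => r _; rewrite coefCM mxE !enum_rankK enum_valK.
Qed.

End Elimination.

(** * Multivariate power series *)

Section SeriesTheory.
Variables (n : nat) (R : comNzRingType).
Implicit Types (f g : mpseries n R) (p q : {mpoly R[n]}) (m k : 'X_{1..n}).

Lemma scoeffD f g m : scoeff (f + g) m = scoeff f m + scoeff g m.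
Proof. by []. Qed.

Lemma scoeffN f m : scoeff (- f) m = - scoeff f m.
Proof. by []. Qed.

Lemma scoeff0 m : scoeff (0 : mpseries n R) m = 0.
Proof. by []. Qed.

Lemma scoeff1 m : scoeff (1 : mpseries n R) m = (m == 0%MM)%:R.
Proof. by []. Qed.

Lemma scoeff_sum (I : Type) (r : seq I) (P : pred I) (F : I -> mpseries n R) m :
  scoeff (\sum_(i <- r | P i) F i) m = \sum_(i <- r | P i) scoeff (F i) m.
Proof. by elim/big_rec2: _ => //= i x y _ <-. Qed.

Lemma scoeffM f g m : scoeff (f * g) m =
  \sum_(k : 'X_{1..n < (mdeg m).+1} | (bmnm k <= m)%MM) scoeff f k * scoeff g (m - k)%MM.
Proof.
rewrite /= (eq_bigl (fun kl => (bmnm kl.1 <= m)%MM && (bmnm kl.2 == m - kl.1)%MM)); last first.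
  move=> kl; case: kl => [[a ?] [b ?]] /=; apply/eqP/andP => [->|[km /eqP ->]].
    by rewrite lem_addr // addmC addmK eqxx.
  by rewrite addmC submK.
rewrite -(pair_big_dep (fun k : 'X_{1..n < (mdeg m).+1} => (bmnm k <= m)%MM)
  (fun k l : 'X_{1..n < (mdeg m).+1} => bmnm l == (m - k)%MM)
  (fun k l : 'X_{1..n < (mdeg m).+1} => scoeff f k * scoeff g l)) /=.
apply: eq_bigr => /= -[k kd] /= km.
have mk : (mdeg (m - k)%MM < (mdeg m).+1)%N by rewrite ltnS mdegB.
by rewrite (big_pred1 (BMultinom mk)).
Qed.

Lemma eq_scoeffM f f' g g' m : 
  (forall k, (mdeg k <= mdeg m)%N -> scoeff f k = scoeff f' k) ->
  (forall k, (mdeg k <= mdeg m)%N -> scoeff g k = scoeff g' k) ->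
  scoeff (f * g) m = scoeff (f' * g') m.
Proof.
move=> ff gg; rewrite !scoeffM; apply: eq_bigr => -[k kd] /= km.
by rewrite ff ?gg // ?mdegB // -ltnS.
Qed.

Definition sX k : mpseries n R := series_of_mpoly 'X_[k].

Lemma scoeffXM k f m :
  scoeff (sX k * f) m = if (k <= m)%MM then scoeff f (m - k)%MM else 0.
Proof.
rewrite scoeffM; case: ifP => km.
  have kd : (mdeg k < (mdeg m).+1)%N by rewrite ltnS; move/mnm_lepP: km => km; rewrite !mdegE leq_sum.
  rewrite (bigD1 (BMultinom kd)) //= mcoeffX eqxx mul1r big1 ?addr0 // => -[l ld] /= /andP[_ lk].
  rewrite mcoeffX; case: eqP => [kl|]; last by rewrite mul0r.
  by case/eqP: lk; apply: val_inj.
rewrite big1 // => -[l ld] /= lm; rewrite mcoeffX; case: eqP => [kl|]; last by rewrite mul0r.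
by rewrite kl lm in km.
Qed.

Definition sC (c : R) : mpseries n R := series_of_mpoly c%:MP.

HB.instance Definition _ := GRing.RMorphism.copy sC
  (@series_of_mpoly n R \o @mpolyC n R).

Lemma scoeffCM c f m : scoeff (sC c * f) m = c * scoeff f m.
Proof.
have -> : sC c * f = sX 0%MM * MPSeries (fun m => c * scoeff f m).
  rewrite /sX mpolyX0 rmorph1 mul1r; apply: mpseriesP => l.
  rewrite scoeffM /=.
  have l0 : (mdeg (0%MM : 'X_{1..n}) < (mdeg l).+1)%N by rewrite mdeg0.
  rewrite (bigD1 (BMultinom l0)) /=; last by apply/mnm_lepP => i; rewrite mnm0E.
  rewrite mcoeffC eqxx mulr1 subm0 big1 ?addr0 // => -[k kd] /= /andP[_ k0].
  rewrite mcoeffC; case: eqP => [kl|]; last by rewrite mulr0 mul0r.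
  by case/eqP: k0; apply: val_inj.
by rewrite /sX mpolyX0 rmorph1 mul1r.
Qed.

Lemma spderivD i f g : spderiv i (f + g) = spderiv i f + spderiv i g.
Proof. by apply: mpseriesP => m /=; rewrite mulrnDl. Qed.

Lemma spderiv0 i : spderiv i (0 : mpseries n R) = 0.
Proof. by apply: mpseriesP => m /=; rewrite mul0rn. Qed.

(** The Leibniz rule is inherited from polynomial truncations. They keep degree [mdeg m + 1], since
    a derivative reads coefficients one degree higher. *)
Lemma spderivM i f g :
  spderiv i (f * g) = spderiv i f * g + f * spderiv i g.
Proof.
apply: mpseriesP => m.
pose tr f : {mpoly R[n]} := \sum_(k : 'X_{1..n < (mdeg m).+2}) scoeff f k *: 'X_[k].
have trE h k : (mdeg k < (mdeg m).+2)%N -> (tr h)@_k = scoeff h k.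
  exact: mcoeff_mpoly.
have mUd k : mdeg (k + U_(i))%MM = (mdeg k).+1 by rewrite mdegD mdeg1 addn1.
have dtrE h k : (mdeg k <= mdeg m)%N ->
    scoeff (spderiv i h) k = scoeff (series_of_mpoly (tr h)^`M(i)) k.
  by move=> km /=; rewrite mcoeff_deriv trE // mUd !ltnS.
have -> : scoeff (spderiv i (f * g)) m = ((tr f * tr g)^`M(i))@_m.
  rewrite mcoeff_deriv; congr (_ *+ _).
  rewrite (@eq_scoeffM f (series_of_mpoly (tr f)) g (series_of_mpoly (tr g))).
  - by rewrite -rmorphM.
  - by move=> k; rewrite mUd => km /=; rewrite trE.
  - by move=> k; rewrite mUd => km /=; rewrite trE.
rewrite mderivM mcoeffD scoeffD; congr (_ + _).
  rewrite (@eq_scoeffM _ (series_of_mpoly (tr f)^`M(i)) _ (series_of_mpoly (tr g))).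
  - by rewrite -rmorphM.
  - by move=> k /dtrE.
  - by move=> k km /=; rewrite trE // ltnW.
rewrite (@eq_scoeffM _ (series_of_mpoly (tr f)) _ (series_of_mpoly (tr g)^`M(i))).
- by rewrite -rmorphM.
- by move=> k km /=; rewrite trE // ltnW.
- by move=> k /dtrE.
Qed.

Lemma spderiv_mpoly i p : spderiv i (series_of_mpoly p) = series_of_mpoly p^`M(i).
Proof. by apply: mpseriesP => m /=; rewrite mcoeff_deriv. Qed.

Lemma spderivC i j f : spderiv i (spderiv j f) = spderiv j (spderiv i f).
Proof.
apply: mpseriesP => m /=; rewrite -!mulrnA !mnmDE -!addmA [(U_(i) + _)%MM]addmC.
rewrite !mnm1E [i == j]eq_sym mulnC; congr (_ *+ _).
by case: eqP => [->|_]; rewrite ?addn0 // mulnC.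
Qed.

End SeriesTheory.

(** * Series over [L[u]] and linear maps acting on their coefficients *)

Section Coefficientwise.
Variables (n : nat) (L : fieldType).
Notation A := (mpseries n {poly L}).
Implicit Types (f g : A) (v : {mpoly L[n]}) (p : {poly {mpoly L[n]}}).

Definition cmap (V : zmodType) (h : {poly L} -> V) f : mpseries n V :=
  MPSeries (fun m => h (scoeff f m)).

Definition polyC_series v : A := series_of_mpoly (map_mpoly polyC v).

HB.instance Definition _ := GRing.RMorphism.copy polyC_series
  (@series_of_mpoly n {poly L} \o map_mpoly (@polyC L)).

Lemma scoeff_polyC_series v m : scoeff (polyC_series v) m = (v@_m)%:P.
Proof. by rewrite /= mcoeff_map_mpoly. Qed.

(** The embedding of [L[x_0, ..., x_(n-1)][u]] in [L[u][[x_0, ..., x_(n-1)]]]. Having [u] as outer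
    variable of the source makes it the one that elimination removes. *)
Definition poly_series : {poly {mpoly L[n]}} -> A :=
  horner_eval (sC n 'X) \o map_poly polyC_series.

HB.instance Definition _ := GRing.RMorphism.on poly_series.

Lemma poly_seriesC v : poly_series v%:P = polyC_series v.
Proof. by rewrite /poly_series /= /horner_eval map_polyC hornerC. Qed.

Lemma poly_seriesX : poly_series 'X = sC n 'X.
Proof. by rewrite /poly_series /= /horner_eval map_polyX hornerX. Qed.

Lemma scoeff_poly_series p m k : (scoeff (poly_series p) m)`_k = (p`_k)@_m.
Proof.
elim/poly_ind: p k => [|p v IH] k; first by rewrite rmorph0 !coef0 mcoeff0.
have -> : poly_series (p * 'X + v%:P) = sC n 'X * poly_series p + polyC_series v.
  by rewrite rmorphD rmorphM /= poly_seriesC poly_seriesX mulrC.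
rewrite scoeffD scoeffCM.
rewrite scoeff_polyC_series coefD coefXM coefC coefD coefMX coefC.
by rewrite mcoeffD IH; case: k => [|k] /=; rewrite ?mcoeff0.
Qed.

Lemma poly_series_inj : injective poly_series.
Proof.
move=> p q pq; apply/polyP => k; apply/mpolyP => m.
by rewrite -!scoeff_poly_series pq.
Qed.

Lemma poly_series_mpolyC (c : {poly L}) :
  poly_series (map_poly (@mpolyC n L) c) = sC n c.
Proof.
apply: mpseriesP => m; apply/polyP => k.
rewrite scoeff_poly_series coef_map -[sC n c]mulr1 scoeffCM scoeff1 mcoeffC.
by rewrite eq_sym; case: eqP => _; rewrite ?mulr1 ?mulr0 ?coef0.
Qed.

Lemma cmap_spderiv (R : comNzRingType) (h : {additive {poly L} -> R}) i f :
  cmap h (spderiv i f) = spderiv i (cmap h f).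
Proof. by apply: mpseriesP => m /=; rewrite raddfMn. Qed.

Lemma cmapD (V : zmodType) (h : {additive {poly L} -> V}) :
  {morph cmap h : f g / f + g}.
Proof. by move=> f g; apply: mpseriesP => m /=; rewrite raddfD. Qed.

Lemma cmap0 (V : zmodType) (h : {additive {poly L} -> V}) : cmap h 0 = 0.
Proof. by apply: mpseriesP => m /=; rewrite raddf0. Qed.

Lemma cmap_sum (V : zmodType) (h : {additive {poly L} -> V}) (I : finType)
    (P : pred I) (F : I -> A) :
  cmap h (\sum_(i | P i) F i) = \sum_(i | P i) cmap h (F i).
Proof. exact: (big_morph _ (cmapD h) (cmap0 h)). Qed.

Lemma cmap_polyCM (h : {linear {poly L} -> {poly L}}) v f :
  cmap h (polyC_series v * f) = polyC_series v * cmap h f.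
Proof.
apply: mpseriesP => m; rewrite [LHS]/= -[X in h X]/(scoeff (polyC_series v * f) m).
rewrite !scoeffM linear_sum; apply: eq_bigr => k _.
by rewrite scoeff_polyC_series !mul_polyC linearZ.
Qed.

Lemma cmap_scalar_polyCM (h : {linear {poly L} -> L^o}) v f :
  cmap (h : {poly L} -> L) (polyC_series v * f) = series_of_mpoly v * cmap (h : {poly L} -> L) f.
Proof.
apply: mpseriesP => m; rewrite [LHS]/= -[X in h X]/(scoeff (polyC_series v * f) m).
rewrite !scoeffM linear_sum; apply: eq_bigr => k _.
by rewrite scoeff_polyC_series !mul_polyC linearZ.
Qed.

Lemma derivation_spderiv i : derivation (@spderiv n {poly L} i).
Proof. by split=> f g; [exact: spderivD | exact: spderivM]. Qed.

Lemma derivation_cmap_deriv : derivation (cmap (@deriv L)).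
Proof.
split=> f g; first exact: (cmapD (@deriv L)).
apply: mpseriesP => m; rewrite [LHS]/= -[X in X^`()]/(scoeff (f * g) m).
rewrite scoeffD !scoeffM linear_sum -big_split; apply: eq_bigr => k _.
by rewrite /= derivM.
Qed.

Lemma lifts_spderiv i : lifts poly_series (@spderiv n {poly L} i).
Proof.
move=> p; exists (map_poly (mderiv i) p); first exact: size_poly.
apply: mpseriesP => m; apply/polyP => k; rewrite scoeff_poly_series coef_map_id0.
  by rewrite mcoeff_deriv -scoeff_poly_series /= coefMn.
exact: mderiv0.
Qed.

Lemma lifts_cmap_deriv : lifts poly_series (cmap (@deriv L)).
Proof.
move=> p; exists p^`(); first by rewrite (leq_trans (size_poly _ _)) ?leq_pred.
apply: mpseriesP => m; apply/polyP => k; rewrite scoeff_poly_series.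
by rewrite [LHS]/= !coef_deriv mcoeffMn -scoeff_poly_series.
Qed.

End Coefficientwise.

(** * D-finiteness from ordinary differential equations *)

Section SpanTheory.
Variables (n : nat) (L : fieldType).
Notation K := {fraction mpseries n L}.
Implicit Types (X Y : set K) (x y : K).

Lemma series_of_mpoly_eq0 (R : comNzRingType) (p : {mpoly R[n]}) :
  (series_of_mpoly p == 0) = (p == 0).
Proof.
apply/eqP/eqP => [p0|->]; last by rewrite rmorph0.
by apply/mpolyP => m; have := congr1 (fun f => scoeff f m) p0; rewrite mcoeff0.
Qed.

Lemma is_ratfunM x y : is_ratfun x -> is_ratfun y -> is_ratfun (x * y).
Proof.
move=> [p [q [q0 ->]]] [p' [q' [q'0 ->]]].
exists (p * p'), (q * q'); split; first exact: mulf_neq0.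
by rewrite !rmorphM /= mulf_div.
Qed.

Lemma span_gen X x : X x -> ratfun_span X x.
Proof.
move=> Xx; exists 1%N, (fun=> 1), (fun=> x); split=> //.
  by move=> _; exists 1, 1; rewrite oner_neq0 !rmorph1 divr1.
by rewrite big_ord1 mul1r.
Qed.

Lemma span0 X : ratfun_span X 0.
Proof. by exists 0%N, (fun=> 0), (fun=> 0); split=> [[]|[]|] //; rewrite big_ord0. Qed.

Lemma spanD X x y : ratfun_span X x -> ratfun_span X y -> ratfun_span X (x + y).
Proof.
move=> [r [c [u [cr uX ->]]]] [r' [c' [u' [cr' uX' ->]]]].
pose glue (a : 'I_r -> K) (b : 'I_r' -> K) (i : 'I_(r + r')) :=
  match fintype.split i with inl j => a j | inr j => b j end.
exists (r + r')%N, (glue c c'), (glue u u'); split.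
- by move=> i; rewrite /glue; case: split.
- by move=> i; rewrite /glue; case: split.
rewrite big_split_ord /=; congr (_ + _); apply: eq_bigr => i _.
  by rewrite /glue (unsplitK (inl i)).
by rewrite /glue (unsplitK (inr i)).
Qed.

Lemma spanZ X c x : is_ratfun c -> ratfun_span X x -> ratfun_span X (c * x).
Proof.
move=> cr [r [d [u [dr uX ->]]]]; exists r, (fun i => c * d i), u; split=> //.
  by move=> i; apply: is_ratfunM.
by rewrite mulr_sumr; apply: eq_bigr => i _; rewrite mulrA.
Qed.

Lemma span_sum X (I : Type) (s : seq I) (F : I -> K) (P : pred I) :
  (forall i, P i -> ratfun_span X (F i)) ->
  ratfun_span X (\sum_(i <- s | P i) F i).
Proof. by move=> FX; elim/big_rec: _ => [|i x Pi]; [exact: span0 | apply: spanD; exact: FX]. Qed.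

Lemma span_le X Y x : (forall z, X z -> ratfun_span Y z) ->
  ratfun_span X x -> ratfun_span Y x.
Proof.
move=> XY [r [c [u [cr uX ->]]]]; apply: span_sum => i _.
by apply: spanZ => //; apply: XY.
Qed.

End SpanTheory.

(** * Mixed partial derivatives and their reduction to lower order *)

Section Words.
Variables (n : nat) (L : fieldType).
Notation B := (mpseries n L).
Implicit Types (F f g x y : B) (w : seq 'I_n) (v : {mpoly L[n]}).

Lemma spderivs_cat w w' f : spderivs (w ++ w') f = spderivs w (spderivs w' f).
Proof. exact: foldr_cat. Qed.

Lemma spderivs_perm w w' f : perm_eq w w' -> spderivs w f = spderivs w' f.
Proof.
move: w'; elim: w => [|i w IH] w' ww'.
  by move/perm_size: ww'; case: w'.
have iw' : i \in w' by rewrite -(perm_mem ww') inE eqxx.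
have swap (u u' : seq 'I_n) : spderivs (u ++ i :: u') f = spderivs (i :: u ++ u') f.
  by elim: u => //= j u ->; rewrite spderivC.
move: ww'; case/splitPr: w' / iw' => u u' ww'.
rewrite swap /= (IH (u ++ u')) //.
by rewrite -(perm_cons i) (perm_trans ww') // -(cat1s i u') perm_catCA.
Qed.

Lemma spderivs_nseq i a f : spderivs (nseq a i) f = iter a (spderiv i) f.
Proof. by elim: a => //= a ->. Qed.

(** The coefficients are polynomials rather than rational functions, so that these combinations
    remain series and can be differentiated. *)
Definition lower F k x := exists2 s : seq ({mpoly L[n]} * seq 'I_n),
  all (fun vw => size vw.2 < k)%N s &
  x = \sum_(vw <- s) series_of_mpoly vw.1 * spderivs vw.2 F.

Lemma lower0 F k : lower F k 0.
Proof. by exists [::]; rewrite ?big_nil. Qed.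

Lemma lower_gen F k v w : (size w < k)%N ->
  lower F k (series_of_mpoly v * spderivs w F).
Proof. by move=> wk; exists [:: (v, w)]; rewrite /= ?wk ?big_seq1. Qed.

Lemma lowerD F k x y : lower F k x -> lower F k y -> lower F k (x + y).
Proof.
move=> [s sk ->] [s' sk' ->]; exists (s ++ s'); first by rewrite all_cat sk.
by rewrite big_cat.
Qed.

Lemma lower_sum F k (I : Type) (r : seq I) (P : pred I) (x : I -> B) :
  (forall i, P i -> lower F k (x i)) -> lower F k (\sum_(i <- r | P i) x i).
Proof. by move=> xk; elim/big_rec: _ => [|i z Pi]; [exact: lower0 | apply: lowerD; exact: xk]. Qed.

Lemma lower_spderiv F k i x : lower F k x -> lower F k.+1 (spderiv i x).
Proof.
move=> [s + ->]; elim: s => [|[v w] s IH] /=.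
  by rewrite big_nil spderiv0 => _; exact: lower0.
move=> /andP[wk sk]; rewrite big_cons spderivD spderivM spderiv_mpoly /=.
do 2?[apply: lowerD]; last exact: IH; first by apply: lower_gen; exact: ltnW.
by rewrite -[spderiv i _]/(spderivs (i :: w) F); apply: lower_gen.
Qed.

Lemma lower_spderivs F k w x : lower F k x -> lower F (size w + k) (spderivs w x).
Proof. by move=> xk; elim: w => //= i w; apply: lower_spderiv. Qed.

Lemma lower_trans F k k' w x :
  lower (spderivs w F) k x -> (k + size w <= k')%N -> lower F k' x.
Proof.
move=> [s sk ->] kk'; rewrite big_seq; apply: lower_sum => -[v w'] /(allP sk) /= w'k.
by rewrite -spderivs_cat; apply: lower_gen; rewrite size_cat; lia.
Qed.

Lemma lowerN F k x : lower F k x -> lower F k (- x).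
Proof.
move=> [s sk ->]; rewrite -sumrN big_seq; apply: lower_sum => -[v w] /(allP sk) /= wk.
by rewrite -mulNr -rmorphN; apply: lower_gen.
Qed.

Lemma spderivs_Leibniz F v w : exists2 x, lower F (size w) x &
  spderivs w (series_of_mpoly v * F) = series_of_mpoly v * spderivs w F + x.
Proof.
elim: w => [|i w [x xw IH]] /=; first by exists 0; rewrite ?addr0 //; exact: lower0.
exists (series_of_mpoly v^`M(i) * spderivs w F + spderiv i x).
  by apply: lowerD; [exact: lower_gen | exact: lower_spderiv].
by rewrite IH spderivD spderivM spderiv_mpoly; ring.
Qed.

Definition ode F i := exists N (v : 'I_N -> {mpoly L[n]}),
  (exists a, v a != 0) /\
  \sum_a series_of_mpoly (v a) * iter a (spderiv i) F = 0.

Lemma ode_leading F i : ode F i -> exists r v, v != 0 /\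
  lower F r (series_of_mpoly v * iter r (spderiv i) F).
Proof.
move=> [N [v [[a0 va0] vF]]].
case: (@arg_maxnP _ a0 (fun a => v a != 0) val va0) => a va amax.
exists a, (v a); split=> //.
move/eqP: vF; rewrite (bigD1 a) //= addr_eq0 => /eqP ->.
apply/lowerN/lower_sum => b ba; have [->|vb] := eqVneq (v b) 0.
  by rewrite rmorph0 mul0r; exact: lower0.
rewrite -spderivs_nseq; apply: lower_gen; rewrite size_nseq ltn_neqAle ba.
exact: amax.
Qed.

(* A word of length at least the sum of the orders of the equations contains
   one letter often enough for the corresponding equation to apply. *)
Lemma ode_Dfinite F : (forall i, ode F i) -> Dfinite F.
Proof.
move=> /(_ _)/ode_leading odeF; have [r rP] := choice odeF.
have {rP}[v vP] := choice rP.
pose R := (\sum_i r i).+1.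
pose low k : set {fraction B} :=
  [set tofrac (spderivs w F) | w in [set w : seq 'I_n | (size w < k)%N]]%classic.
have lower_low k x : lower F k x -> ratfun_span (low k) (tofrac x).
  move=> [s sk ->]; rewrite rmorph_sum /= big_seq; apply: span_sum => -[p w].
  move=> /(allP sk) /= wk; rewrite rmorphM; apply: spanZ.
    by exists p, 1; rewrite oner_neq0 !rmorph1 divr1.
  by apply: span_gen; exists w.
have step w : (R <= size w)%N -> ratfun_span (low (size w)) (tofrac (spderivs w F)).
  move=> Rw; have [i iw] : exists i, (r i <= count_mem i w)%N.
    apply/existsP; apply: contraLR Rw; rewrite negb_exists => /forallP rw.
    have -> : size w = (\sum_i count_mem i w)%N.
      elim: w {rw} => [|j w IH] /=; first by rewrite big1.
      rewrite big_split /= -IH (bigD1 j) //= eqxx big1 // => k.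
      by rewrite eq_sym => /negPf ->.
    rewrite -ltnNge ltnS; apply: leq_sum => i _; apply: ltnW.
    by rewrite ltnNge; apply: rw.
  have ww : perm_eq w ([seq j <- w | j != i] ++ nseq (count_mem i w) i).
    rewrite perm_sym perm_catC.
    rewrite (_ : nseq _ _ = [seq j <- w | j == i]); last first.
      by elim: w {Rw iw} => //= j w <-; case: eqP => [->|].
    by rewrite (perm_filterC (pred1 i) w).
  have [v0 vl] := vP i; move: (v i) v0 vl => p p0 pl.
  move: [seq j <- w | j != i] ww => u ww.
  rewrite -(subnK iw) nseqD catA in ww.
  move: (u ++ _) ww => {}u ww.
  have swu : size w = (size u + r i)%N.
    by rewrite (perm_size ww) size_cat size_nseq.
  (* Applying the remaining derivatives [u] to the equation in [x_i] gives [p] times the derivative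
     along [w], up to terms of lower order; both sides then reduce to order below [size w]. *)
  have [x xu E] := spderivs_Leibniz (iter (r i) (spderiv i) F) p u.
  have plow : lower F (size w) (series_of_mpoly p * spderivs w F).
    rewrite (spderivs_perm _ ww) spderivs_cat spderivs_nseq.
    rewrite -[X in lower _ _ X](addrK x) -E; apply: lowerD.
      by rewrite swu; apply: lower_spderivs.
    apply: lowerN; move: xu; rewrite -spderivs_nseq => /lower_trans; apply.
    by rewrite size_nseq swu.
  have p0' : tofrac (series_of_mpoly p) != 0 by rewrite tofrac_eq0 series_of_mpoly_eq0.
  rewrite -[X in ratfun_span _ X](mulKf p0') -rmorphM.
  apply: spanZ; last exact: lower_low.
  by exists 1, p; rewrite p0 rmorph1 tofrac1 mul1r.
have all_low w : ratfun_span (low R) (tofrac (spderivs w F)).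
  move: {2}(size w) (leqnn (size w)) => k; elim: k w => [|k IH] w wk.
    by apply: span_gen; exists w => //=; lia.
  have [wR|Rw] := ltnP (size w) R; first by apply: span_gen; exists w.
  apply: span_le (step w Rw) => _ [w' /= w'w <-]; apply: IH.
  by rewrite -ltnS (leq_trans w'w).
(* There are finitely many words shorter than [R], and their derivatives are the generators. *)
have [s sP] : exists s : seq (seq 'I_n), forall w, (size w < R)%N -> w \in s.
  exists (flatten [seq [seq val t | t <- enum {: k.-tuple 'I_n}] | k <- iota 0 R]).
  move=> w wR; apply/flatten_mapP; exists (size w); first by rewrite mem_iota.
  by apply/mapP; exists (in_tuple w); rewrite ?mem_enum.
exists [seq tofrac (spderivs w F) | w <- s].
apply/seteqP; split=> x; apply: span_le => {}x /=.
  move=> [w _ <-]; apply: span_le (all_low w) => _ [w' /= w'R <-].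
  by apply: span_gen; apply/mapP; exists w' => //; apply: sP.
by move=> /mapP[w _ ->]; apply: span_gen; exists w.
Qed.

End Words.

(** * Chebyshev polynomials and the semicircle form *)

Section Chebyshev.
Variable L : numFieldType.
Implicit Types (p q : {poly L}).

(* With [u = z + 1/z], [cheb n] is [(z^(n+1) - z^-(n+1)) / (z - 1/z)]. *)
Fixpoint cheb (n : nat) : {poly L} :=
  if n is n'.+1 then (if n' is n''.+1 then 'X * cheb n' - cheb n'' else 'X)
  else 1.

Lemma chebSS n : cheb n.+2 = 'X * cheb n.+1 - cheb n.
Proof. by []. Qed.

(* Multiplication by [u] in the basis [cheb], the vector [cheb n] being encoded
   by ['X^n]. *)
Definition jacobi p : {poly L} := p * 'X + drop_poly 1 p.

Lemma coef_jacobi p k :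
  (jacobi p)`_k = (if k is k'.+1 then p`_k' else 0) + p`_k.+1.
Proof. by rewrite coefD coefMX coef_drop_poly addn1; case: k. Qed.

Fact jacobi_linear : linear jacobi.
Proof.
move=> a p q; apply/polyP => k; rewrite [RHS]coefD coefZ !coef_jacobi.
by case: k => [|k]; rewrite ?coefD ?coefZ; ring.
Qed.
HB.instance Definition _ := GRing.isLinear.Build L {poly L} {poly L} _ jacobi
  jacobi_linear.

(** The coordinates of [p] in the basis [cheb], obtained by evaluating [p] at the operator [jacobi]
    and applying the result to the vector of [cheb 0]. *)
Definition cheb_coords p : {poly L} := \sum_(i < size p) p`_i *: iter i jacobi 1.

Lemma cheb_coordsE n p : (size p <= n)%N ->
  cheb_coords p = \sum_(i < n) p`_i *: iter i jacobi 1.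
Proof.
move=> pn; rewrite /cheb_coords (big_ord_widen n (fun i => p`_i *: iter i jacobi 1) pn).
rewrite [RHS](bigID (fun i : 'I_n => (i < size p)%N)) /=.
rewrite [X in _ + X]big1 ?addr0 // => i.
by rewrite -leqNgt => pi; rewrite nth_default ?scale0r.
Qed.

Fact cheb_coords_linear : linear cheb_coords.
Proof.
move=> a p q; pose n := maxn (size p) (size q).
have pn : (size p <= n)%N by rewrite leq_maxl.
have qn : (size q <= n)%N by rewrite leq_maxr.
rewrite (cheb_coordsE pn) (cheb_coordsE qn) (@cheb_coordsE n); last first.
  rewrite (leq_trans (size_polyD _ _)) // geq_max qn andbT.
  by rewrite (leq_trans (size_scale_leq _ _)).
rewrite scaler_sumr -big_split; apply: eq_bigr => i _ /=.
by rewrite coefD coefZ scalerDl scalerA.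
Qed.
HB.instance Definition _ := GRing.isLinear.Build L {poly L} {poly L} _ cheb_coords
  cheb_coords_linear.

Lemma cheb_coords1 : cheb_coords 1 = 1.
Proof. by rewrite /cheb_coords size_poly1 big_ord1 coef1 scale1r. Qed.

Lemma cheb_coordsX p : cheb_coords ('X * p) = jacobi (cheb_coords p).
Proof.
have pX : (size ('X * p)%R <= (size p).+1)%N.
  by rewrite (leq_trans (size_polyMleq _ _)) // size_polyX.
rewrite (cheb_coordsE pX) big_ord_recl coefXM scale0r add0r.
rewrite /cheb_coords linear_sum; apply: eq_bigr => i _.
by rewrite coefXM linearZ.
Qed.

Lemma cheb_coords_cheb n : cheb_coords (cheb n) = 'X^n.
Proof.
suff [] : cheb_coords (cheb n) = 'X^n /\ cheb_coords (cheb n.+1) = 'X^(n.+1) by [].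
elim: n => [|n [IH0 IH1]]; last first.
  split=> //; rewrite chebSS linearB /= cheb_coordsX IH0 IH1.
  apply/polyP => k; rewrite coefB coef_jacobi !coefXn.
  by case: k => [|k]; rewrite !eqSS /= ?eqSS ?coefXn; ring.
rewrite cheb_coords1; split=> //.
rewrite /= -['X]mulr1 cheb_coordsX cheb_coords1 mulr1.
apply/polyP => k; rewrite coef_jacobi !coef1 coefX.
by case: k => [|k]; rewrite ?coef1 ?eqSS ?addr0 ?add0r.
Qed.

(** Integration against the semicircle law on [[-2, 2]], for which the [cheb n] are orthonormal:
    only the coordinate on [cheb 0 = 1] survives. *)
Definition semicircle p : L := (cheb_coords p)`_0.

Fact semicircle_linear : linear (semicircle : {poly L} -> L^o).
Proof. by move=> a p q; rewrite /semicircle linearP coefD coefZ. Qed.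
HB.instance Definition _ := GRing.isLinear.Build L {poly L} L^o _ semicircle
  semicircle_linear.

(** The recurrence of [cheb] is also the one relating successive coordinates under [jacobi], whose
    matrix is symmetric; hence an induction carrying two consecutive indices. *)
Lemma semicircle_chebM n p : semicircle (cheb n * p) = (cheb_coords p)`_n.
Proof.
suff [] : (forall p, semicircle (cheb n * p) = (cheb_coords p)`_n) /\
  (forall p, semicircle (cheb n.+1 * p) = (cheb_coords p)`_n.+1) by [].
elim: n {p} => [|n [IH0 IH1]]; last first.
  split=> // p; rewrite chebSS mulrBl linearB /= -mulrA mulrCA IH0 IH1.
  by rewrite cheb_coordsX coef_jacobi /=; ring.
split=> p; first by rewrite mul1r.
by rewrite /semicircle cheb_coordsX coef_jacobi add0r.
Qed.

Lemma semicircle_orthonormal i j : semicircle (cheb i * cheb j) = (i == j)%:R.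
Proof. by rewrite semicircle_chebM cheb_coords_cheb coefXn. Qed.

(* The adjoint, up to sign, of [(4 - u^2) d/du] for the weight
   [sqrt (4 - u^2)] of the semicircle law. *)
Definition pearson p : {poly L} := (4%:R - 'X^2) * p^`() - 3%:R * 'X * p.

Fact pearson_linear : linear pearson.
Proof.
move=> a p q; rewrite /pearson derivD derivZ -!mul_polyC; ring.
Qed.
HB.instance Definition _ := GRing.isLinear.Build L {poly L} {poly L} _ pearson
  pearson_linear.

(* [pearson (cheb n) = (n - 1) cheb (n - 1) - (n + 3) cheb (n + 1)]. *)
Lemma coef_cheb_coords_pearson p k : (cheb_coords (pearson p))`_k =
  (cheb_coords p)`_k.+1 *+ k -
    (if k is k'.+1 then (cheb_coords p)`_k' else 0) *+ k.+2.
Proof.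
elim/poly_ind: p k => [|p c IH] k.
  by rewrite !linear0 !coef0; case: k => [|k]; rewrite ?coef0; ring.
have -> : pearson (p * 'X + c%:P) = 'X * pearson p + 4%:R *: p - 'X * ('X * p)
    - (3%:R * c) *: ('X * 1).
  rewrite /pearson derivD derivM derivC derivX -!mul_polyC polyCM !polyC_natr.
  by ring.
have -> : p * 'X + c%:P = 'X * p + c *: 1 by rewrite mulrC -mul_polyC mulr1.
rewrite !(linearB, linearD, linearZ) /= !cheb_coordsX cheb_coords1.
rewrite !(coefB, coefZ, coef_jacobi, coefD).
by case: k => [|[|[|k]]];
  rewrite ?(coef_jacobi, IH, coefZ, coefN, coefD, coef1) /=
    ?(coef_jacobi, IH, coefZ, coefN, coefD, coef1) /=; ring.
Qed.

Lemma semicircle_pearson p : semicircle (pearson p) = 0.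
Proof. by rewrite /semicircle coef_cheb_coords_pearson mulr0n mul0rn subr0. Qed.

(** A leading term [a u^n] is sent to [-(n + 3) a u^(n+1)], which is nonzero in characteristic
    zero. *)
Lemma pearson_eq0 p : pearson p = 0 -> p = 0.
Proof.
move=> Tp; apply/eqP; rewrite -lead_coef_eq0 lead_coefE; set n := (size p).-1.
have pn k : (n < k)%N -> p`_k = 0.
  by move=> nk; rewrite nth_default //; move: nk; rewrite /n; case: (size p).
have : (pearson p)`_n.+1 = - p`_n *+ n.+3.
  rewrite /pearson mulrBl !coefB -!polyC_natr -mulrA !coefCM coefXM /=.
  rewrite expr2 -mulrA !coefXM !coef_deriv (pn n.+2) //.
  by case: n {pn} => [|n] /=; ring.
by move/eqP; rewrite Tp coef0 eq_sym mulrn_eq0 oppr_eq0.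
Qed.

End Chebyshev.

(** * The kernel method *)

Local Notation ix := (@Ordinal 3 0 isT).
Local Notation iy := (@Ordinal 3 1 isT).
Local Notation it := (@Ordinal 3 2 isT).

Lemma mnm3P (m m' : 'X_{1..3}) :
  m ix = m' ix -> m iy = m' iy -> m it = m' it -> m = m'.
Proof.
move=> ex ey et; apply/mnmP => -[[|[|[|//]]] lt3].
- by rewrite (_ : Ordinal lt3 = ix) //; apply: val_inj.
- by rewrite (_ : Ordinal lt3 = iy) //; apply: val_inj.
- by rewrite (_ : Ordinal lt3 = it) //; apply: val_inj.
Qed.

Section Kernel.
Notation A := (mpseries 3 {poly rat}).
Implicit Types (f g : A) (m : 'X_{1..3}).

Let y : A := sX {poly rat} U_(iy)%MM.
Let t : A := sX {poly rat} U_(it)%MM.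

Lemma sX_exp (k : 'X_{1..3}) b : sX {poly rat} k ^+ b = sX {poly rat} (k *+ b)%MM.
Proof. by rewrite /sX -rmorphXn mpolyXn. Qed.

Lemma lem_Un i b m : (U_(i) *+ b <= m)%MM = (b <= m i)%N.
Proof.
apply/mnm_lepP/idP => [/(_ i)|bm j]; rewrite mulmnE mnm1E.
  by rewrite eqxx mul1n.
by case: eqP => [<-|]; rewrite ?mul1n.
Qed.

Lemma scoeff_yM b f m : scoeff (y ^+ b * f) m =
  if (b <= m iy)%N then scoeff f (m - U_(iy) *+ b)%MM else 0.
Proof. by rewrite sX_exp scoeffXM lem_Un. Qed.

Lemma scoeff_tM f m : scoeff (t * f) m =
  if (0 < m it)%N then scoeff f (m - U_(it))%MM else 0.
Proof. by rewrite scoeffXM -[U_(it)%MM]mulm1n lem_Un mulm1n. Qed.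

Definition ylow p f := forall m, (p <= m iy)%N -> scoeff f m = 0.

Lemma ylowD p f g : ylow p f -> ylow p g -> ylow p (f + g).
Proof. by move=> fp gp m pm; rewrite scoeffD fp ?gp ?addr0. Qed.

Lemma ylowN p f : ylow p f -> ylow p (- f).
Proof. by move=> fp m pm; rewrite scoeffN fp ?oppr0. Qed.

(** These series serve as the coefficient ring when series are regarded as polynomials in [y]. *)
Definition yfree f := forall m, m iy != 0%N -> scoeff f m = 0.

Lemma yfree0 : yfree 0. Proof. by []. Qed.

Lemma yfreeD f g : yfree f -> yfree g -> yfree (f + g).
Proof. by move=> f0 g0 m my; rewrite scoeffD f0 ?g0 ?addr0. Qed.

Lemma yfreeN f : yfree f -> yfree (- f).
Proof. by move=> f0 m my; rewrite scoeffN f0 ?oppr0. Qed.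

Lemma yfreeM f g : yfree f -> yfree g -> yfree (f * g).
Proof.
move=> f0 g0 m my; rewrite scoeffM big1 // => -[k kd] /= /mnm_lepP/(_ iy) km.
have [ky|/f0 ->] := eqVneq (k iy) 0%N; last by rewrite mul0r.
by rewrite g0 ?mulr0 // mnmBE ky subn0.
Qed.

Lemma yfree_sC c : yfree (sC 3 c).
Proof.
move=> m my; rewrite -[sC 3 c]mulr1 scoeffCM scoeff1; case: eqP => [m0|_].
  by rewrite m0 mnm0E in my.
by rewrite mulr0.
Qed.

Lemma yfree1 : yfree 1.
Proof. by rewrite -(rmorph1 (@sC 3 {poly rat})); apply: yfree_sC. Qed.

Lemma yfree_t : yfree t.
Proof.
move=> m my; rewrite -[t]mulr1 scoeff_tM scoeff1; case: ifP => // tm.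
case: eqP => // m0; move: my.
by have := congr1 (fun k : 'X_{1..3} => k iy) m0; rewrite mnmBE mnm1E subn0 mnm0E => ->.
Qed.

Definition ycoef b f : A :=
  MPSeries (fun m => if m iy == 0%N then scoeff f (m + U_(iy) *+ b)%MM else 0).

Lemma yfree_ycoef b f : yfree (ycoef b f).
Proof. by move=> m /negPf /= ->. Qed.

Lemma scoeff_ysum p (r : nat -> A) m : (forall b, yfree (r b)) ->
  scoeff (\sum_(b < p) r b * y ^+ b) m =
  if (m iy < p)%N then scoeff (r (m iy)) (m - U_(iy) *+ m iy)%MM else 0.
Proof.
move=> r0; rewrite scoeff_sum.
have rE b : scoeff (r b * y ^+ b) m =
    if b == m iy then scoeff (r b) (m - U_(iy) *+ b)%MM else 0.
  rewrite mulrC scoeff_yM; case: (ltngtP b (m iy)) => [bm|//|->//].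
  by rewrite r0 // mnmBE mulmnE mnm1E eqxx mul1n subn_eq0 -ltnNge.
case: ltnP => [mp|pm].
  rewrite (bigD1 (Ordinal mp)) // rE eqxx big1 => [|b]; first exact: addr0.
  by rewrite -val_eqE rE => /negPf ->.
by rewrite big1 // => b _; rewrite rE ltn_eqF // (leq_trans (ltn_ord b)).
Qed.

Lemma ylow_ycoef p f : ylow p f -> f = \sum_(b < p) ycoef b f * y ^+ b.
Proof.
move=> fp; apply: mpseriesP => m; rewrite (@scoeff_ysum p (ycoef^~ f)); last first.
  by move=> b; apply: yfree_ycoef.
case: ltnP => [mp|/fp //]; rewrite /= mnmBE mulmnE mnm1E eqxx mul1n subnn /=.
by rewrite submK // lem_Un.
Qed.

Lemma ysum_eq0 p (r : nat -> A) : (forall b, yfree (r b)) ->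
  \sum_(b < p) r b * y ^+ b = 0 -> forall b, (b < p)%N -> r b = 0.
Proof.
move=> rf s0 b bp; apply: mpseriesP => m; rewrite scoeff0.
have [my|/rf //] := eqVneq (m iy) 0%N.
have := congr1 (fun f => scoeff f (m + U_(iy) *+ b)%MM) s0.
by rewrite scoeff0 scoeff_ysum // mnmDE mulmnE mnm1E my eqxx mul1n bp addmK.
Qed.

(** * Factorization of the kernel *)

Section Factor.
Variables (p : nat) (W : A).
Hypothesis p_gt0 : (0 < p)%N.
Let K := y ^+ p - t * W.

(** The part of [K * f] of lowest order in [t] comes from [y^p * f], hence has exponents at least
    [p] in [y]. The proof is an induction on the exponent of [t]. *)
Lemma kernel_unique f : ylow p (K * f) -> f = 0.
Proof.
move=> Kf; apply: mpseriesP => m; rewrite scoeff0.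
move: {2}(m it) (leqnn (m it)) => n; elim: n m => [|n IH] m mn.
  have := Kf (m + U_(iy) *+ p)%MM; rewrite mnmDE mulmnE mnm1E eqxx mul1n leq_addl.
  rewrite mulrBl scoeffD scoeffN scoeff_yM -mulrA scoeff_tM.
  rewrite !mnmDE !mulmnE !mnm1E eqxx mul1n leq_addl addmK.
  by rewrite mul0n addn0 ltnNge mn subr0 => ->.
have := Kf (m + U_(iy) *+ p)%MM; rewrite mnmDE mulmnE mnm1E eqxx mul1n leq_addl.
rewrite mulrBl scoeffD scoeffN scoeff_yM -mulrA scoeff_tM.
rewrite !mnmDE !mulmnE !mnm1E eqxx mul1n leq_addl addmK.
rewrite mul0n addn0; case: ifP => [m0|_]; last by rewrite subr0 => ->.
rewrite scoeffM big1 ?subr0; first by move=> ->.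
move=> -[k kd] /= km; rewrite IH ?mulr0 //.
by rewrite !mnmBE !mnmDE !mulmnE !mnm1E /=; lia.
Qed.


Variable alg : A -> Prop.
Hypothesis algA : algebraically_closed_in alg.

Variables (G : nat -> A) (KY : {poly A}).
Hypothesis KY_eval : KY.[y] = K.
Hypothesis KY_yfree : forall b, yfree KY`_b.
Hypothesis KY_alg : forall b, alg KY`_b.
Hypothesis y_alg : alg y.
Hypothesis G_kernel : forall j, ylow p (K * G j - y ^+ (p + j)).

Let rest j := K * G j - y ^+ (p + j).

(** The polynomial [N_0], in an indeterminate standing for [y] as in [KY]. Being monic, it can
    divide [KY]. *)
Let NY : {poly A} := 'X^p + \poly_(b < p) ycoef b (rest 0).

Let NY_size : size NY = p.+1.
Proof. by rewrite size_polyDl size_polyXn // ltnS size_poly. Qed.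

Let NY_monic : NY \is monic.
Proof. by rewrite monicE lead_coefDl ?lead_coefXn // size_polyXn ltnS size_poly. Qed.

Let NY_eval : NY.[y] = K * G 0.
Proof.
rewrite hornerD hornerXn horner_poly -ylow_ycoef; last exact: G_kernel.
by rewrite /rest addn0 addrC subrK.
Qed.

Let kernel_neq0 : K != 0.
Proof.
apply/eqP => K0; suff /eqP : (1 : A) = 0 by rewrite oner_eq0.
by apply: kernel_unique; rewrite -/K K0 mul0r.
Qed.

(** The remainder [r] has degree less than [p] in [y], and its value at [y] is [K * (1 - q G_0)]. By
    [kernel_unique] the second factor vanishes, hence so does [r]. *)
Let NY_dvd : exists q, KY = q * NY.
Proof.
have [|q [r [E rs qf rf]]] := @closed_monic_division A yfree NY KY yfree0 yfreeD
  yfreeN yfreeM NY_monic _ KY_yfree.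
  move=> b; rewrite coefD coefXn coef_poly; apply: yfreeD.
    by case: eqP => _; [exact: yfree1 | exact: yfree0].
  by case: ifP => _; [exact: yfree_ycoef | exact: yfree0].
exists q; rewrite E; suff -> : r = 0 by rewrite addr0.
have rp : (size r <= p)%N by rewrite -ltnS -NY_size.
have rE : r.[y] = K * (1 - q.[y] * G 0).
  rewrite mulrBr mulr1 mulrCA -NY_eval -KY_eval E hornerD hornerM.
  by rewrite addrC addKr.
have rlow : r.[y] = \sum_(b < p) r`_b * y ^+ b by apply: horner_coef_wide.
have r0 : r.[y] = 0.
  rewrite rE; apply/eqP; rewrite mulf_eq0; apply/orP; right; apply/eqP.
  apply: kernel_unique => m pm; rewrite -/K -rE rlow scoeff_ysum // ltnNge pm //.
apply/polyP => b; rewrite coef0; have [bp|pb] := ltnP b p.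
  by apply: (@ysum_eq0 p (fun b => r`_b)) => //; rewrite -rlow.
by rewrite nth_default // (leq_trans rp).
Qed.

Let rest0_alg b : (b < p)%N -> alg (ycoef b (rest 0)).
Proof.
move=> bp; have [q KYE] := NY_dvd.
have := alg_factor algA _ NY_monic (ex_intro _ q KYE) KY_alg b.
rewrite coefD coefXn coef_poly bp ltn_eqF // add0r; apply.
by apply: contra_neq kernel_neq0 => K0; rewrite -KY_eval K0 horner0.
Qed.

(** Coefficients of [y * rest j] below [y^p]; the top coefficient of [rest j] is carried to [y^p]
    and treated apart. *)
Let shift j b := if b is b'.+1 then ycoef b' (rest j) else 0.

Let shift_yfree j b : yfree (shift j b).
Proof. by case: b => [|b]; [exact: yfree0 | exact: yfree_ycoef]. Qed.

Let restE j : rest j = \sum_(b < p) ycoef b (rest j) * y ^+ b.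
Proof. by apply: ylow_ycoef; apply: G_kernel. Qed.

Let shiftE j :
  y * rest j - ycoef p.-1 (rest j) * y ^+ p = \sum_(b < p) shift j b * y ^+ b.
Proof.
rewrite {1}restE; case: p p_gt0 => // p' _.
rewrite big_ord_recr /= mulrDr mulrCA -exprS addrK mulr_sumr.
rewrite big_ord_recl mul0r add0r; apply: eq_bigr => b _.
by rewrite mulrCA -exprS.
Qed.

Let rest_combE j (c := ycoef p.-1 (rest j)) :
  y * rest j - c * y ^+ p - c * rest 0 =
  \sum_(b < p) (shift j b - c * ycoef b (rest 0)) * y ^+ b.
Proof.
rewrite shiftE [in LHS](restE 0) mulr_sumr -sumrB.
by apply: eq_bigr => b _; rewrite mulrBl mulrA.
Qed.

Let comb_yfree j (c := ycoef p.-1 (rest j)) b :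
  yfree (shift j b - c * ycoef b (rest 0)).
Proof. by apply/yfreeD/yfreeN/yfreeM => //; apply: yfree_ycoef. Qed.

(** Subtracting [c * G 0], with [c] the top coefficient of [rest j], cancels the overflow at [y^p].
    Both sides then solve the same kernel equation up to degree less than [p] in [y]. *)
Let G_step j : G j.+1 = y * G j - ycoef p.-1 (rest j) * G 0.
Proof.
set c := ycoef _ _; apply/eqP; rewrite -subr_eq0; apply/eqP/kernel_unique.
have -> : (y ^+ p - t * W) * (G j.+1 - (y * G j - c * G 0)) =
    rest j.+1 - (y * rest j - c * y ^+ p - c * rest 0).
  by rewrite /rest -/K addn0 addnS exprS; ring.
apply/ylowD/ylowN; first exact: G_kernel.
move=> m pm; rewrite rest_combE.
rewrite (@scoeff_ysum p (fun b => shift j b - c * ycoef b (rest 0))) ?ltnNge ?pm //.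
Qed.

Let rest_step j b (c := ycoef p.-1 (rest j)) : (b < p)%N ->
  ycoef b (rest j.+1) = shift j b - c * ycoef b (rest 0).
Proof.
move=> bp; apply/eqP; rewrite -subr_eq0; apply/eqP.
pose r b := ycoef b (rest j.+1) - (shift j b - c * ycoef b (rest 0)).
apply: (@ysum_eq0 p r) bp => [b'|].
  by apply/yfreeD/yfreeN; [exact: yfree_ycoef | exact: comb_yfree].
rewrite /r; under eq_bigr => i _ do rewrite mulrBl.
rewrite sumrB -restE -rest_combE; apply/eqP; rewrite subr_eq0; apply/eqP.
rewrite {1}/rest G_step -/c; move: c {r} => c'.
by rewrite /rest addn0 addnS exprS; ring.
Qed.

(** The coefficients of [rest 0] are algebraic because [NY] divides [KY], those of [rest j] follow
    by recurrence on [j], and finally [K] is cancelled. *)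
Lemma kernel_algebraic j : alg (G j).
Proof.
have Kalg : alg K.
  rewrite -KY_eval horner_coef; apply: (alg_sum algA) => i _.
  by apply: (algM algA); [exact: KY_alg | exact: (algX algA)].
have rest_alg i b : (b < p)%N -> alg (ycoef b (rest i)).
  elim: i b => [|i IH] b bp; first exact: rest0_alg.
  rewrite rest_step //; apply: (algB algA); last first.
    by apply: (algM algA); [apply: IH; rewrite prednK | exact: rest0_alg].
  by case: b bp => [|b] bp; [exact: (alg0 algA) | apply: IH; apply: ltnW].
apply: (alg_cancel algA kernel_neq0 Kalg).
have -> : K * G j = rest j + y ^+ (p + j) by rewrite subrK.
apply: (algD algA); last exact: (algX algA).
rewrite restE; apply: (alg_sum algA) => b _.
by apply: (algM algA); [exact: rest_alg | exact: (algX algA)].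
Qed.

End Factor.
End Kernel.

(** * Walks *)

Section WalkCount.
Variables (S : {fset int * int}) (p : int * int).
Implicit Types (q s : int * int) (l : nat).

(** Recursion on the last step keeps the start fixed and matches the recursion of [half_line]. *)
Fixpoint walk_list l q : seq (seq (int * int)) :=
  if l is l'.+1 then
    if in_quadrant q then [seq rcons w q | s <- S, w <- walk_list l' (q - s)]
    else [::]
  else if in_quadrant p && (p == q) then [:: [::]] else [::].

Lemma mem_walk_list l q w : w \in walk_list l q <-> quadrant_walks S p q l w.
Proof.
elim: l q w => [|l IH] q w.
  rewrite /=; case: ifP => [/andP[pQ /eqP <-]|pq].
    rewrite inE; split=> [/eqP ->|[/size0nil -> //]].
    by split=> //=; rewrite pQ.
  split=> // -[/size0nil -> _ /= pqE]; rewrite andbT => pQ.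
  by rewrite pQ pqE eqxx in pq.
rewrite [walk_list _ _]/=; split=> [|[sw pw lw aw]].
  case: ifP => // qQ /allpairsPdep[s [w' [sS /IH[sw pw lw aw] ->]]].
  split; rewrite ?size_rcons ?sw ?last_rcons //.
    by rewrite rcons_path pw lw subKr.
  by rewrite -rcons_cons all_rcons qQ.
case/lastP: w => [//|w z] in sw pw lw aw *.
move: sw pw lw aw; rewrite size_rcons rcons_path last_rcons -rcons_cons all_rcons.
move=> [sw] /andP[pw zS] zq; rewrite zq in zS * => /andP[zQ aw]; rewrite zQ.
apply/allpairsPdep; exists (q - last p w), w; split=> //.
by apply/IH; split; rewrite ?subKr.
Qed.

Lemma uniq_walk_list l q : uniq (walk_list l q).
Proof.
elim: l q => [|l IH] q /=; first by case: ifP.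
case: ifP => // _; apply: allpairs_uniq_dep => [|s _|]; [exact: fset_uniq | exact: IH|].
move=> [s w] [s' w'] /allpairsPdep[s1 [w1 [_ w1l [-> ->]]]].
move=> /allpairsPdep[s2 [w2 [_ w2l [-> ->]]]] /= /rcons_inj[ww].
rewrite ww in w1l *; move: w1l w2l => /mem_walk_list[_ _ l1 _] /mem_walk_list[_ _ l2 _].
by have -> : s1 = s2 by apply: (subrI q); rewrite -l1 -l2.
Qed.

Lemma nb_walk_list l q : nb_quadrant_walks S p q l = size (walk_list l q).
Proof.
rewrite /nb_quadrant_walks.
have -> : fset_set (quadrant_walks S p q l) = [fset w in walk_list l q]%fset.
  apply/fsetP => w; rewrite in_fset_set; last exact: finite_quadrant_walks.
  rewrite !inE; apply/idP/idP => [|/mem_walk_list wl]; first by rewrite inE => /mem_walk_list.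
  by rewrite inE.
by rewrite card_fseq undup_id // uniq_walk_list.
Qed.

Lemma nb_quadrant_walks0 q :
  nb_quadrant_walks S p q 0 = in_quadrant p && (p == q) :> nat.
Proof. by rewrite nb_walk_list /=; case: ifP. Qed.

Lemma nb_quadrant_walksS q l : nb_quadrant_walks S p q l.+1 =
  if in_quadrant q then (\sum_(s <- S) nb_quadrant_walks S p (q - s)%R l)%N else 0%N.
Proof.
rewrite nb_walk_list /=; case: ifP => // _.
rewrite size_allpairs_dep sumnE big_map.
by apply: eq_bigr => s _; rewrite nb_walk_list.
Qed.

End WalkCount.

(** * Weighted half-line walks and their kernel equation *)

Section HalfLine.
Variable S : {fset int * int}.

(* By the symmetry of the steps, a step [(a, b)] with [a = 1] or [a = -1]
   may be given the weight [u / 2]. *)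
Definition step_weight (a : int) : {poly rat} :=
  if a == 0 then 1 else (2%:R^-1)%:P * 'X.

(** The height is an integer so that [j - s.2] may leave the half line, where the value is [0]. *)
Fixpoint half_line (j0 l : nat) (j : int) : {poly rat} :=
  if j < 0 then 0 else
  if l is l'.+1 then \sum_(s <- S) step_weight s.1 * half_line j0 l' (j - s.2)
  else (j == j0%:Z)%:R.

Lemma half_line_neg j0 l j : j < 0 -> half_line j0 l j = 0.
Proof. by case: l => [|l] /= ->. Qed.

Lemma half_line0 j0 (n : nat) : half_line j0 0 n = (n == j0)%:R.
Proof. by []. Qed.

Lemma half_lineS j0 l (n : nat) : half_line j0 l.+1 n =
  \sum_(s <- S) step_weight s.1 * half_line j0 l (n%:Z - s.2).
Proof. by []. Qed.

Definition half_series (j0 : nat) : mpseries 3 {poly rat} :=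
  MPSeries (fun m => if m ix == 0%N then half_line j0 (m it) (m iy)%:Z else 0).

(** Multiplication by [y^depth] clears the negative powers of [y] in the step polynomial. The
    successor makes [depth] positive, as the factorization of the kernel requires. *)
Definition depth : nat := (\sum_(s <- S) `|s.2|%N).+1.

Definition shifted (b : int) : nat := absz (depth%:Z + b).

Lemma shiftedE s : s \in S -> (shifted s.2)%:Z = depth%:Z + s.2.
Proof.
move=> sS; have : (`|s.2| <= \sum_(s <- S) `|s.2|)%N.
  by rewrite (big_rem s) //= leq_addr.
by rewrite /shifted /depth; lia.
Qed.

Let y : mpseries 3 {poly rat} := sX {poly rat} U_(iy)%MM.
Let t : mpseries 3 {poly rat} := sX {poly rat} U_(it)%MM.

Definition step_series : mpseries 3 {poly rat} :=
  \sum_(s <- S) sC 3 (step_weight s.1) * y ^+ shifted s.2.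

(** From [y^depth] on, comparing coefficients is the recursion on the last step; below it, nothing
    is claimed, and this is where the unknown boundary terms lie. *)
Lemma half_series_kernel j0 :
  ylow depth ((y ^+ depth - t * step_series) * half_series j0 - y ^+ (depth + j0)).
Proof.
move=> m pm; rewrite mulrBl !scoeffD !scoeffN scoeff_yM pm -mulrA scoeff_tM.
rewrite -[y ^+ (depth + j0)]mulr1 scoeff_yM scoeff1.
have halfE k : scoeff (half_series j0) k =
   if k ix == 0%N then half_line j0 (k it) (k iy)%:Z else 0 by [].
have -> : scoeff (half_series j0) (m - U_(iy) *+ depth)%MM =
   if m ix == 0%N then half_line j0 (m it) (m iy - depth)%N%:Z else 0.
  by rewrite halfE !mnmBE !mulmnE !mnm1E /= mul1n mul0n !subn0.
have y1 : (if (depth + j0 <= m iy)%N then (m - U_(iy) *+ (depth + j0) == 0)%MM%:R else 0) =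
   ((m ix == 0%N) && (m it == 0%N) && (m iy == depth + j0)%N)%:R :> {poly rat}.
  case: ifP => [dm|/negbT dm]; last first.
    by rewrite [in RHS]andbC; case: eqP => // me; rewrite me leqnn in dm.
  congr (_ %:R); congr nat_of_bool; apply/eqP/andP.
    move=> m0; have mE i := congr1 (fun k : 'X_{1..3} => k i) m0.
    have := mE ix; have := mE iy; have := mE it.
    rewrite !mnmBE !mulmnE !mnm1E !mnm0E /= => mt my mx.
    split; first by apply/andP; split; apply/eqP; lia.
    by apply/eqP; lia.
  move=> [/andP[/eqP mx /eqP mt] /eqP my]; apply: mnm3P;
  rewrite !mnmBE !mulmnE !mnm1E !mnm0E /=; lia.
rewrite y1; case mt: (m it) => [|l]; rewrite ?half_line0 ?half_lineS.
  rewrite oppr0 addr0; case: eqP => [mx|_]; last by rewrite subrr.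
  rewrite (_ : (_ == _) = (m iy == depth + j0)%N) ?subrr //.
  by apply/eqP/eqP; lia.
rewrite andbF subr0 /step_series mulr_suml scoeff_sum.
have termE s : s \in S ->
  scoeff (sC 3 (step_weight s.1) * y ^+ shifted s.2 * half_series j0) (m - U_(it))%MM =
  if m ix == 0%N then step_weight s.1 * half_line j0 l ((m iy - depth)%N%:Z - s.2) else 0.
  move=> sS; rewrite -mulrA scoeffCM scoeff_yM mnmBE mnm1E subn0 /=.
  rewrite !mnmBE !mulmnE !mnm1E /= mul0n !subn0 mt subn1 /= mul1n.
  have sE := shiftedE sS.
  (* If the exponent of [y] is too small for the shift, the step would come from a negative height,
     where [half_line] vanishes. *)
  case: ifP => [sm|/negbT sm]; last first.
    case: ifP => _; rewrite ?mulr0 //.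
    rewrite half_line_neg ?mulr0 //; move: sm sE pm; rewrite -ltnNge.
    by move: (m iy) depth (s.2 : int) (shifted s.2) => a c d b; lia.
  case: ifP => _; rewrite ?mulr0 //; congr (_ * half_line _ _ _).
  by move: sm sE pm; move: (m iy) depth (s.2 : int) (shifted s.2) => a c d b; lia.
rewrite (eq_big_seq _ termE).
case: ifP => _; first by rewrite subrr.
by rewrite big1 ?subrr.
Qed.

End HalfLine.

(** * Quadrant walks through the semicircle form *)

Section QuadrantWalks.
Variable S : {fset int * int}.
Hypothesis S_sym : forall i j : int, (i, j) \in S -> (- i, j) \in S.
Hypothesis S_small : forall i j : int, (i, j) \in S -> `|i| <= 1.

(** The value [0] at [-1] is imposed by the recurrence at [0]; it is what confines the horizontal
    coordinate to the half line. *)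
Definition chebz (a : int) : {poly rat} := if a is Posz n then cheb rat n else 0.

Lemma chebz_neg a : a < 0 -> chebz a = 0.
Proof. by case: a. Qed.

Lemma chebz_step a : 0 <= a -> 'X * chebz a = chebz (a + 1) + chebz (a - 1).
Proof.
case: a => // -[|n] _; first by rewrite [chebz (0 - 1)]chebz_neg // addr0 add0r /= mulr1.
have -> : n.+1%:Z + 1 = n.+2 by lia.
have -> : n.+1%:Z - 1 = n by lia.
by rewrite [chebz n.+2]/chebz chebSS subrK.
Qed.

Lemma chebz_weight a i : 0 <= a -> `|i| <= 1 ->
  chebz (a - i) + chebz (a + i) = step_weight i * chebz a *+ 2.
Proof.
move=> a0 i1; rewrite /step_weight; case: eqP => [->|i0].
  by rewrite subr0 mul1r mulr2n.
have -> : chebz (a - i) + chebz (a + i) = 'X * chebz a.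
  have [->|->] : i = 1 \/ i = -1 by lia.
    by rewrite chebz_step // addrC.
  by rewrite chebz_step // opprK.
by rewrite -[RHS]mulr_natl !mulrA -polyC_natr -polyCM mulfV // mul1r.
Qed.

Lemma sum_mirror (V : nmodType) (h : int * int -> V) :
  \sum_(s <- S) h s = \sum_(s <- S) h (- s.1, s.2).
Proof.
pose bar (s : int * int) := (- s.1, s.2).
rewrite -(big_map bar xpredT h); apply: perm_big; apply: uniq_perm.
- exact: fset_uniq.
- rewrite map_inj_uniq ?fset_uniq // => -[a b] [c d] [/oppr_inj -> ->] //.
move=> [a b]; apply/idP/mapP => [abS|[[c d] cdS [-> ->]]]; last exact: S_sym.
by exists (- a, b); rewrite ?opprK //; [exact: S_sym | rewrite /bar opprK].
Qed.

(* Only the number of horizontal steps of a half-plane walk matters in the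
   horizontal direction, where [u] acts on the basis [cheb] as a [+-1] step on
   the half line. *)
Lemma nb_quadrant_walksE (i0 j0 l : nat) (q : int * int) :
  (nb_quadrant_walks S (i0%:Z, j0%:Z) q l)%:R =
  semicircle (cheb rat i0 * (chebz q.1 * half_line S j0 l q.2)).
Proof.
elim: l q => [|l IH] [a b].
  rewrite nb_quadrant_walks0 [in_quadrant _]/= [(a, b).1]/= [(a, b).2]/=.
  case: a => a; last by rewrite mul0r mulr0 linear0.
  case: b => b; last by rewrite !mulr0 linear0 xpair_eqE andbF.
  rewrite half_line0 /chebz xpair_eqE !eqz_nat [b == _]eq_sym.
  case: (j0 =P b) => _; last by rewrite andbF !mulr0 linear0.
  by rewrite mulr1 semicircle_orthonormal andbT.
rewrite nb_quadrant_walksS; case: ifP => [/andP[a0 b0]|].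
  rewrite /= in a0 b0.
  rewrite natr_sum; under eq_bigr => s _ do rewrite IH.
  rewrite -linear_sum -mulr_sumr; congr (semicircle (_ * _)).
  rewrite [(a, b).1]/= [(a, b).2]/=.
  case: b b0 => // b _; rewrite half_lineS mulr_sumr.
  have n2 : (2%:R : {poly rat}) != 0 by rewrite -polyC_natr polyC_eq0.
  (* Twice the sum is the sum over the steps plus the sum over their mirror images, so that
     [chebz_weight] applies to each pair. *)
  apply: (mulIf n2); rewrite !mulr_natr mulr2n.
  rewrite {1}sum_mirror -big_split -sumrMnl; apply: eq_big_seq => -[i j] /= sS.
  rewrite opprK -mulrDl addrC chebz_weight ?(S_small sS) //.
  by rewrite mulrnAl mulrAC mulrA [chebz _ * _]mulrC mulrAC.
rewrite /in_quadrant => /negbT; rewrite negb_and -!ltNge => /orP[a0|b0].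
  by rewrite chebz_neg // mul0r mulr0 linear0.
by rewrite half_line_neg // !mulr0 linear0.
Qed.

Variables (i0 j0 : nat).
Notation A := (mpseries 3 {poly rat}).
Notation phi := (@poly_series 3 rat).

Definition quadrant_u_series : A := MPSeries (fun m =>
  cheb rat i0 * (cheb rat (m ix) * half_line S j0 (m it) (m iy)%:Z)).

Lemma quadrant_series_semicircle :
  quadrant_series S i0 j0 = cmap (@semicircle rat) quadrant_u_series.
Proof. by apply: mpseriesP => m; rewrite /= nb_quadrant_walksE. Qed.

Lemma sX_image (k : 'X_{1..3}) : phi ('X_[k])%:P = sX {poly rat} k.
Proof.
rewrite poly_seriesC; apply: mpseriesP => m.
rewrite scoeff_polyC_series /= !mcoeffX.
by case: eqP.
Qed.

Lemma quadrant_u_series_algebraic : is_algebraic phi quadrant_u_series.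
Proof.
have algA := algebraic_closed (@poly_series_inj 3 rat).
set alg := is_algebraic _ in algA *.
have alg_sC c : alg (sC 3 c).
  by rewrite -poly_series_mpolyC; apply: is_algebraic_image.
have alg_sX k : alg (sX {poly rat} k).
  by rewrite -sX_image; apply: is_algebraic_image.
pose y : A := sX {poly rat} U_(iy)%MM; pose t : A := sX {poly rat} U_(it)%MM.
pose KY : {poly A} := 'X^(depth S) -
  \sum_(s <- S) (t * sC 3 (step_weight s.1)) *: 'X^(shifted S s.2).
(* One closure argument for the coefficients of [KY], used both for [yfree] and for [alg]. *)
have KYcoef (C : A -> Prop) b : C 0 -> C 1 -> (forall f g, C f -> C g -> C (f + g)) ->
    (forall f, C f -> C (- f)) -> (forall f g, C f -> C g -> C (f * g)) ->
    C t -> (forall c, C (sC 3 c)) -> C KY`_b.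
  move=> C0 C1 CD CN CM Ct CC; rewrite coefB coefXn; apply: (CD).
    by case: eqP.
  apply: (CN); rewrite coef_sum; elim/big_rec: _ => // s x _ Cx; apply: (CD) => //.
  by rewrite coefZ coefXn; apply: (CM); [exact: CM | case: eqP].
have Galg : alg (half_series S j0).
  have := @kernel_algebraic (depth S) (step_series S) isT alg algA (half_series S) KY.
  apply=> //.
  - rewrite hornerD hornerN hornerXn horner_sum; congr (_ - _).
    rewrite /step_series mulr_sumr; apply: eq_bigr => s _.
    by rewrite hornerZ hornerXn mulrA.
  - move=> b; apply: KYcoef; [exact: yfree0|exact: yfree1|exact: yfreeD|exact: yfreeN
      |exact: yfreeM|exact: yfree_t|exact: yfree_sC].
  - move=> b; apply: KYcoef => //; [exact: (alg0 algA)|exact: (alg1 algA)|exact: (algD algA)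
      | |exact: (algM algA)|exact: alg_sX].
    by move=> f fa; rewrite -sub0r; apply: (algB algA) => //; exact: (alg0 algA).
  - exact: half_series_kernel.
pose x : A := sX {poly rat} U_(ix)%MM.
(* The denominator of the generating function of the [cheb i], whose sum against [x^i] is
   [1 / (1 - u x + x^2)]. *)
pose d : A := 1 - x * sC 3 'X + x * x.
have dalg : alg d.
  apply: (algD algA); last by apply: (algM algA); exact: alg_sX.
  apply: (algB algA); first exact: (alg1 algA).
  by apply: (algM algA); [exact: alg_sX | exact: alg_sC].
have xM (f : A) m : scoeff (x * f) m = if (0 < m ix)%N then scoeff f (m - U_(ix))%MM else 0.
  by rewrite scoeffXM -[U_(ix)%MM]mulm1n lem_Un mulm1n.
have d0 : d != 0.
  apply/eqP => /(congr1 (fun f => scoeff f 0%MM)).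
  rewrite !scoeffD scoeffN !xM mnm0E /= eqxx oppr0 !addr0 => /eqP.
  by rewrite oner_eq0.
apply: (alg_cancel algA d0 dalg).
suff -> : d * quadrant_u_series = sC 3 (cheb rat i0) * half_series S j0.
  by apply: (algM algA).
apply: mpseriesP => m; rewrite scoeffCM mulrDl mulrBl mul1r -!mulrA.
rewrite !scoeffD scoeffN !xM scoeffCM.
rewrite [scoeff (half_series _ _) _]/= /quadrant_u_series /=.
rewrite !mnmBE !mnm1E /= !subn0.
case: (m ix) => [|[|n]] /=.
- by rewrite subr0 addr0 mul1r.
- by ring.
by rewrite !subn1 /=; ring.
Qed.

End QuadrantWalks.

(** * Conclusion *)

Section SemicircleODE.
Variables (n : nat) (L : numFieldType).
Notation A := (mpseries n {poly L}).
Notation phi := (@poly_series n L).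

Let T : A -> A := cmap (@pearson L).

Let T_polyCM v k (f : A) : iter k T (polyC_series v * f) = polyC_series v * iter k T f.
Proof. by elim: k => //= k ->; rewrite [T _]cmap_polyCM. Qed.

Let T_spderiv i a k (f : A) :
  iter k T (iter a (spderiv i) f) = iter a (spderiv i) (iter k T f).
Proof.
have T1 g : T (spderiv i g) = spderiv i (T g) by exact: (cmap_spderiv (@pearson L)).
elim: k => //= k ->; elim: a {f} (iter k T f) => //= a IH f.
by rewrite T1 IH.
Qed.

Let T_sum k (I : finType) (P : pred I) (f : I -> A) :
  iter k T (\sum_(i | P i) f i) = \sum_(i | P i) iter k T (f i).
Proof. by elim: k => //= k ->; rewrite [T _]cmap_sum. Qed.

Let T_inj k (f : A) : iter k T f = 0 -> f = 0.
Proof.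
elim: k => //= k IH Tf; apply: IH; apply: mpseriesP => m.
by apply: pearson_eq0; exact: (congr1 (fun g => scoeff g m) Tf).
Qed.

Let semicircle_iterT a i k (f : A) : (0 < k)%N ->
  cmap (@semicircle L) (iter a (spderiv i) (iter k T f)) = 0.
Proof.
case: k => // k _; rewrite -T_spderiv; apply: mpseriesP => m /=.
exact: semicircle_pearson.
Qed.

Lemma algebraic_semicircle_ode (F : A) i : is_algebraic phi F ->
  ode (cmap (@semicircle L) F) i.
Proof.
move=> Falg; have S_char0 k : k.+1%:R != 0 :> {mpoly L[n]}.
  by rewrite -mpolyC_nat mpolyC_eq0 pnatr_eq0.
have := @algebraic_elimination _ _ _ (@poly_series_inj n L) S_char0 F
  (@spderiv n _ i) (cmap (@deriv L)) (4%:R - 'X^2) (- (3%:R * 'X)) Falg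
  (@derivation_spderiv n L i) (@lifts_spderiv n L i)
  (@derivation_cmap_deriv n L) (@lifts_cmap_deriv n L).
have TE f : phi (4%:R - 'X^2) * cmap (@deriv L) f + phi (- (3%:R * 'X)) * f = T f.
  have -> : phi (4%:R - 'X^2) = sC n (4%:R - 'X^2).
    by rewrite -poly_series_mpolyC; congr phi; rewrite rmorphB rmorph_nat rmorphXn /= map_polyX.
  have -> : phi (- (3%:R * 'X)) = sC n (- (3%:R * 'X)).
    by rewrite -poly_series_mpolyC; congr phi; rewrite rmorphN rmorphM rmorph_nat /= map_polyX.
  apply: mpseriesP => m; rewrite scoeffD !scoeffCM mulNr.
  by rewrite /T /= /pearson.
move=> [N [v [[a0 [b0 v0]]]]]; rewrite (funext TE) => E.
(* With [b] the least exponent of [T] present, the relation is [T^b] applied to [H] below, so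
   [H = 0] by injectivity of [T]. In [H] the terms with [b' > b] are still in the image of [T] and
   are killed by the semicircle form. *)
case: (@arg_minnP _ b0 (fun b => [exists a, v a b != 0]) val) => [|b /existsP[a va] bmin].
  by apply/existsP; exists a0.
exists N, (fun a => v a b); split; first by exists a.
have vlt a' (b' : 'I_N) : (b' < b)%N -> v a' b' = 0.
  move=> b'b; apply/eqP/negPn/negP => v'; move: b'b; rewrite ltnNge bmin //.
  by apply/existsP; exists a'.
pose H : A := \sum_a' \sum_(b' < N | (b <= b')%N)
  polyC_series (v a' b') * iter a' (spderiv i) (iter (b' - b)%N T F).
have H0 : H = 0.
  apply: (@T_inj b); rewrite -E /H T_sum; apply: eq_bigr => a' _.
  rewrite T_sum [RHS](bigID (fun b' : 'I_N => (b <= b')%N)) /=.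
  rewrite [X in _ + X]big1 ?addr0 => [|b']; last first.
    by rewrite -ltnNge => b'b; rewrite vlt // rmorph0 mul0r.
  apply: eq_bigr => b' bb'.
  by rewrite T_polyCM poly_seriesC T_spderiv -iterD subnKC.
transitivity (cmap (@semicircle L) H); last by rewrite H0 cmap0.
rewrite /H cmap_sum; apply: eq_bigr => a' _.
rewrite cmap_sum (bigD1 b) //= [X in _ + X]big1 ?addr0 => [|b' /andP[bb' b'b]].
  rewrite subnn /= cmap_scalar_polyCM; congr (_ * _).
  by elim: (nat_of_ord a') => //= k ->; rewrite cmap_spderiv.
rewrite cmap_scalar_polyCM semicircle_iterT ?mulr0 // subn_gt0 ltn_neqAle bb'.
by rewrite eq_sym (_ : (_ == _) = (b' == b)) // b'b.
Qed.

End SemicircleODE.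

Theorem theorem3 (S : {fset int * int})
    (S_sym : forall i j : int, (i, j) \in S -> (- i, j) \in S)
    (S_small : forall i j : int, (i, j) \in S -> `|i| <= 1)
    (i0 j0 : nat) :
  Dfinite (quadrant_series S i0 j0).
Proof.
rewrite quadrant_series_semicircle //; apply: ode_Dfinite => i.
exact/algebraic_semicircle_ode/quadrant_u_series_algebraic.
Qed.
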